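(* Let $H_1=\begin{bmatrix} f_1&u_1\\ g_1&v_1\end{bmatrix}$ and $H_2=\begin{bmatrix} f_2&u_2\\ g_2&v_2\end{bmatrix}$ be $2\times 2$ matrices with entries in $L^\infty$. Consider the equation $$\begin{bmatrix} V(\bar f_1)_-\\ (g_1)_-\end{bmatrix}\otimes\begin{bmatrix} V(f_2)_-\\ (\bar u_2)_-\end{bmatrix}-\begin{bmatrix} V(\bar u_1)_-\\ (v_1)_-\end{bmatrix}\otimes\begin{bmatrix} V(g_2)_-\\ (\bar v_2)_-\end{bmatrix}=\begin{bmatrix} V(\bar f_2)_-\\ (g_2)_-\end{bmatrix}\otimes\begin{bmatrix} V(f_1)_-\\ (\bar u_1)_-\end{bmatrix}-\begin{bmatrix} V(\bar u_2)_-\\ (v_2)_-\end{bmatrix}\otimes\begin{bmatrix} V(g_1)_-\\ (\bar v_1)_-\end{bmatrix}.\quad(\ast)$$ Assume that both sides of $(\ast)$ are rank two operators. Then $R_{H_1}R_{H_2}=R_{H_2}R_{H_1}$ if and only if there exist constants $a,b,c,d$ such that all of the following functions belong to $H^\infty$: $$\bar f_1-\bar a\bar f_2-\bar b\bar u_2,\quad g_1-ag_2-bv_2,\quad \bar u_1-\bar c\bar f_2-\bar d\bar u_2,\quad v_1-cg_2-dv_2,$$ $$f_1-af_2+cg_2,\quad \bar u_1-\bar a\bar u_2+\bar c\bar v_2,\quad g_1+bf_2-dg_2,\quad \bar v_1+\bar b\bar u_2-\bar d\bar v_2,$$ $$\bar u_2\bar f_1-\bar v_1\bar u_2-\bar a\bar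 u_2\bar f_2-\bar b\bar u_2^2+\bar c\bar v_2\bar f_2+\bar d\bar v_2\bar u_2,$$ $$v_1g_2-f_1g_2+ag_2f_2+bv_2f_2-cg_2^2-dv_2g_2.$$
   Context: $L^2$ and $L^\infty$ are the Lebesgue spaces of the unit circle $\mathbb T$ with normalized Lebesgue measure. $H^2\subset L^2$ is the Hardy space (functions whose negative Fourier coefficients vanish), $P_+$ is the orthogonal projection of $L^2$ onto $H^2$, $P_-=I-P_+$, and $H^\infty=L^\infty\cap H^2$. A bar denotes complex conjugation. For $x\in L^2$, $x_-=P_-x$. $V$ is the anti-unitary operator on $L^2$ given by $Vx=\bar z\bar x$; $V(x)_-$ means $V(P_-x)$. For vectors $p,q$ in a Hilbert space, $p\otimes q$ is the operator $x\mapsto\langle x,q\rangle p$; columns $\begin{bmatrix} x\\ y\end{bmatrix}$ with $x,y\in L^2$ are vectors of $L^2\oplus L^2$. For $H=\begin{bmatrix} f&u\\ g&v\end{bmatrix}$ with entries in $L^\infty$, the generalized Cauchy singular integral operator with symbol $H$ is the operator on $L^2$ given by $R_Hx=P_+fP_+x+P_-gP_+x+P_+uP_-x+P_-vP_-x$. *)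

(* Defs.v *)
From HB Require Import structures.
From mathcomp Require Import all_boot all_order all_algebra.
From mathcomp Require Import generic_quotient ring_quotient.
From mathcomp Require Import all_classical all_reals all_analysis.
From mathcomp Require Import measurable_realfun.
From mathcomp Require Import complex.

Set Implicit Arguments.
Unset Strict Implicit.
Unset Printing Implicit Defensive.

Import Order.TTheory GRing.Theory Num.Theory Normc.

Local Open Scope classical_set_scope.
Local Open Scope ring_scope.
Local Open Scope complex_scope.

(* The unit circle is parametrized by theta |-> exp (i theta): a function on the
   circle is a function of the angle theta, taken modulo equality almost
   everywhere for the uniform probability on [0, 2 pi]. In particular its values
   outside [0, 2 pi] are irrelevant. *)
Section functions_on_the_circle.
Context (R : realType).

Lemma twopi_gt0 : 0 < pi *+ 2 :> R.
Proof. by rewrite pmulrn_rgt0 ?pi_gt0. Qed.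

Definition circle_measure : probability (measurableTypeR R) R :=
  uniform_prob twopi_gt0.

Definition cmeasurable (f : R -> R[i]) : Prop :=
  measurable_fun [set: measurableTypeR R] (fun t => complex.Re (f t)) /\
  measurable_fun [set: measurableTypeR R] (fun t => complex.Im (f t)).

Definition cLfun (p : \bar R) : set (R -> R[i]) :=
  [set f | cmeasurable f /\
           (fun t => normc (f t)) \in Lfun circle_measure p].

Definition cintegral (f : R -> R[i]) : R[i] :=
  Rintegral circle_measure setT (fun t => complex.Re (f t)) +i*
  Rintegral circle_measure setT (fun t => complex.Im (f t)).

(* The coordinate function z. *)
Definition zfun (t : R) : R[i] := cos t +i* sin t.

Definition L2pred : {pred (R -> R[i])} := mem (cLfun 2%:E).

Lemma cmeasurableD f g : cmeasurable f -> cmeasurable g -> cmeasurable (f + g).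
Proof.
move=> [fr fi] [gr gi]; split.
  rewrite (_ : (fun t => _) = (fun t => complex.Re (f t) + complex.Re (g t))).
    exact: measurable_funD.
  by apply/funext => t /=; rewrite [LHS]raddfD.
rewrite (_ : (fun t => _) = (fun t => complex.Im (f t) + complex.Im (g t))).
  exact: measurable_funD.
by apply/funext => t /=; rewrite [LHS]raddfD.
Qed.

Lemma cmeasurableZ (a : R[i]) f : cmeasurable f -> cmeasurable (a *: f).
Proof.
case: a => a b [fr fi]; split.
  rewrite (_ : (fun t => _) =
      (fun t => a * complex.Re (f t) - b * complex.Im (f t))).
    by apply: measurable_funB; exact: measurable_funM.
  by apply/funext => t; rewrite fctE /= /GRing.scale/=; case: (f t).
rewrite (_ : (fun t => _) =
    (fun t => a * complex.Im (f t) + b * complex.Re (f t))).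
  by apply: measurable_funD; exact: measurable_funM.
by apply/funext => t; rewrite fctE /= /GRing.scale/=; case: (f t).
Qed.

Lemma cmeasurable_normc f : cmeasurable f ->
  measurable_fun [set: measurableTypeR R] (fun t => normc (f t)).
Proof.
move=> [mr mi].
have -> : (fun t => normc (f t)) =
  (fun t => Num.sqrt (complex.Re (f t) ^+ 2 + complex.Im (f t) ^+ 2)).
  by apply/funext => t; case: (f t).
apply: (@measurableT_comp _ _ _ _ _ _ (@Num.sqrt R)).
  exact: continuous_measurable_fun (@sqrt_continuous R).
by apply: measurable_funD; exact: measurable_funX.
Qed.

Lemma Lfun2_dominated (f g : measurableTypeR R -> R) : measurable_fun setT g ->
  f \in Lfun circle_measure 2%:E -> (forall t, 0 <= g t <= f t) ->
  g \in Lfun circle_measure 2%:E.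
Proof.
move=> mg + gf; rewrite inE => /andP[/[!inE]/= mf Nf].
apply/andP; split; rewrite inE//=.
apply: le_lt_trans Nf; rewrite unlock /Lnorm.
have mpow (h : measurableTypeR R -> R) : measurable_fun setT h ->
    measurable_fun setT (fun t => (`|(EFin \o h) t| `^ 2)%E).
  move=> mh; apply/measurable_EFinP.
  apply: (@measurableT_comp _ _ _ _ _ _ (@powR R ^~ 2)) => //.
  exact: measurableT_comp.
rewrite gt0_ler_poweR ?in_itv/= ?leey ?andbT//.
- by apply: integral_ge0 => t _; rewrite lee_fin powR_ge0.
- by apply: integral_ge0 => t _; rewrite lee_fin powR_ge0.
- apply: ge0_le_integral => //; [exact: mpow|exact: mpow|] => t _ /=.
  have /andP[g0 gft] := gf t.
  by rewrite lee_fin !ger0_norm ?(le_trans g0)// ge0_ler_powR// nnegrE ?(le_trans g0).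
Qed.

Lemma L2pred_submod_closed : submod_closed L2pred.
Proof.
split.
  rewrite inE/=; split.
    by split; exact: measurable_cst.
  suff -> : (fun t : R => normc ((0 : R -> R[i]) t)) = cst 0.
    exact: Lfun_cst.
  by apply/funext => t; rewrite [LHS]normc0.
move=> a f g; rewrite !inE => -[mf Lf] [mg Lg].
have mh : cmeasurable (a *: f + g).
  by apply: cmeasurableD => //; exact: cmeasurableZ.
split=> //.
apply: (@Lfun2_dominated
  ((normc a \o* (fun t => normc (f t))) + (fun t => normc (g t)))).
- exact: cmeasurable_normc.
- apply: rpredD => [|twoge1|//]; first by rewrite lee_fin ler1n.
  by apply: Lfun_scale => //; exact: ler1n.
- move=> t; apply/andP; split.
    by case: ((_ + _) t) => x y; exact: sqrtr_ge0.
  rewrite [leRHS](_ : _ = normc (a * f t) + normc (g t)); last first.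
    by rewrite normcM mulrC.
  exact: le_normcD.
Qed.

HB.instance Definition _ :=
  GRing.isSubmodClosed.Build R[i] (R -> R[i]) L2pred L2pred_submod_closed.

Record L2fun := MkL2fun { L2fun_val :> R -> R[i]; _ : L2fun_val \in L2pred }.

HB.instance Definition _ := [isSub for L2fun_val].
HB.instance Definition _ := [Choice of L2fun by <:].
HB.instance Definition _ := [SubChoice_isSubLmodule of L2fun by <:].

Definition null_pred : {pred L2fun} :=
  mem [set f : L2fun | {ae circle_measure, forall t : measurableTypeR R, f t = 0}].

Lemma null_pred_submod_closed : submod_closed null_pred.
Proof.
split; first by rewrite inE; apply: aeW.
move=> a f g; rewrite !inE => f0 g0.
apply: filterS2 f0 g0 => t ft gt.
by rewrite -[LHS]/(a *: f t + g t) ft gt scaler0 addr0.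
Qed.

HB.instance Definition _ :=
  GRing.isSubmodClosed.Build R[i] L2fun null_pred null_pred_submod_closed.

Definition L2 : Type := Quotient.quot null_pred.

HB.instance Definition _ := GRing.Zmodule.on L2.
HB.instance Definition _ := EqQuotient.on L2.

Local Open Scope quotient_scope.

Definition L2scale (a : R[i]) (x : L2) : L2 := \pi_L2 (a *: repr x).

Lemma pi_L2scale a (f : L2fun) : L2scale a (\pi_L2 f) = \pi_L2 (a *: f).
Proof.
apply/eqP; rewrite -Quotient.idealrBE -scalerBr rpredZ//.
by rewrite Quotient.idealrBE reprK.
Qed.

Lemma pi_L2D (f g : L2fun) : \pi_L2 (f + g) = \pi_L2 f + \pi_L2 g.
Proof. by rewrite !piE. Qed.

Lemma L2scaleA a b x : L2scale a (L2scale b x) = L2scale (a * b) x.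
Proof. by elim/quotP: x => x _; rewrite (pi_L2scale b x) !pi_L2scale scalerA. Qed.

Lemma L2scale1 : left_id 1 L2scale.
Proof. by elim/quotP => x _; rewrite pi_L2scale scale1r. Qed.

Lemma L2scaleDr : right_distributive L2scale +%R.
Proof.
move=> a; elim/quotP => x _; elim/quotP => y _.
by rewrite -pi_L2D !pi_L2scale -pi_L2D scalerDr.
Qed.

Lemma L2scaleDl x : {morph L2scale^~ x : a b / a + b}.
Proof.
by elim/quotP: x => x _ a b; rewrite !pi_L2scale -pi_L2D scalerDl.
Qed.

HB.instance Definition _ := GRing.Zmodule_isLmodule.Build R[i] L2
  L2scaleA L2scale1 L2scaleDr L2scaleDl.

Definition L2repr (x : L2) : R -> R[i] := repr x.
Local Coercion L2repr : L2 >-> Funclass.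

(* The class of a square-integrable function, and 0 for any other function. *)
Definition toL2 (f : R -> R[i]) : L2 := \pi_L2 (insubd (0 : L2fun) f).

Definition conjL2 (x : L2) : L2 := toL2 (fun t => (x t)^*%C).

(* Only used when at least one of the factors is essentially bounded. *)
Definition mulL2 (f x : L2) : L2 := toL2 (fun t => f t * x t).

Definition inner (x y : L2) : R[i] := cintegral (fun t => x t * (y t)^*%C).

Definition fourier_coef (x : L2) (n : int) : R[i] :=
  cintegral (fun t => x t * (zfun t ^ n)^*%C).

Definition Linfty : set L2 := [set f | cLfun +oo%E f].

Definition hardy2 : set L2 := [set x | forall n : int, n < 0 -> fourier_coef x n = 0].

Definition Hinfty : set L2 := Linfty `&` hardy2.

(* The orthogonal projection onto a closed subspace M; such a projection is
   unique when it exists. *)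
Definition orth_proj (M : set L2) (x : L2) : L2 :=
  xget 0 [set y | M y /\ forall h, M h -> inner (x - y) h = 0].

Definition Pplus (x : L2) : L2 := orth_proj hardy2 x.

Definition Pminus (x : L2) : L2 := x - Pplus x.

Definition Vop (x : L2) : L2 := toL2 (fun t => (zfun t)^*%C * (x t)^*%C).

(* The symbol is the matrix [f u; g v]. *)
Definition RH (H : 'M[L2]_2) (x : L2) : L2 :=
  Pplus (mulL2 (H 0 0) (Pplus x)) + Pminus (mulL2 (H 1 0) (Pplus x)) +
  Pplus (mulL2 (H 0 1) (Pminus x)) + Pminus (mulL2 (H 1 1) (Pminus x)).

(* The column [x; y] of the orthogonal sum of two copies of L2 is the
   pair (x, y). *)
Definition inner2 (p q : L2 * L2) : R[i] := inner p.1 q.1 + inner p.2 q.2.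

Definition tensor (p q : L2 * L2) (x : L2 * L2) : L2 * L2 := inner2 x q *: p.

End functions_on_the_circle.

Notation "f ** x" := (mulL2 f x) (at level 40, left associativity) : ring_scope.

(* The range of T has dimension n. *)
Definition has_rank (K : fieldType) (U W : lmodType K) (T : U -> W) (n : nat) :
    Prop :=
  exists e : 'I_n -> W,
    (forall a : 'I_n -> K, \sum_i a i *: e i = 0 -> forall i, a i = 0) /\
    range T = [set w | exists a : 'I_n -> K, w = \sum_i a i *: e i].

(* Main.v *)
From HB Require Import structures.
Require Import Defs.
From mathcomp Require Import all_boot all_order all_algebra.
From mathcomp Require Import all_classical all_reals all_analysis.
From mathcomp Require Import complex.
From mathcomp Require Import measurable_realfun ess_sup_inf zify ring lra.

Set Implicit Arguments.
Unset Strict Implicit.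
Unset Printing Implicit Defensive.

Import Order.TTheory GRing.Theory Num.Theory.
Import numFieldNormedType.Exports.
Local Open Scope classical_set_scope.
Local Open Scope ring_scope.

(** The space splits as the Hardy space plus its orthogonal complement, with
projections [Pplus] and [Pminus], and the commutator of two operators [RH] is
a matrix of four entries for this splitting. All of them are sums of products
of two Toeplitz or Hankel operators.

Sufficiency is algebra. The first eight conditions say that, between the two
summands, the Hankel operators of [f1], [g1], [u1], [v1] are combinations of
those of [f2], [g2], [u2], [v2], because multiplication by a function of
[Hinfty] preserves the Hardy space and multiplication by its conjugate
preserves the complement. After substitution the two diagonal entries of the
commutator cancel ([diagonal_entry]), and the two others become Hankel
operators whose symbols are the last function and the conjugate of the one
before it ([mixed_entry]); these operators vanish exactly when the last two
functions are analytic ([blocks_commuteP]).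

For necessity, compare each entry of the commutator with its compression by the
shift [z]. The shift commutes with the projection up to an operator of rank
one, [P (z y) = z (P y) + <y, z^-1> 1], so that the difference of an entry and
its compression is a sum of four tensors, and the four vanishing entries give
the identity between tensors on the sum of two copies of the space
([blocks_commute_tensor]). Two equal operators of rank two, written as
[p1 (x) q1 - p2 (x) q2], are related by an invertible change of basis
([rank_two_eq]); its coefficients are the constants [a], [b], [c], [d], and the
relations between the vectors are the first eight conditions. The last two
follow from the mixed entries, as above.

The analysis behind this is the existence of the projection and the fact that
its range and kernel are described by Fourier coefficients. The projection
theorem ([orthogonal_decomposition]) rests on completeness ([L2_complete], from
[riesz_fischer]). That functions with complementary Fourier spectra are
orthogonal ([hardy_antihardy_orth]) rests on the totality of the powers of [z]
([zfun_total]): trigonometric polynomials, composed with the polynomials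
[(1 - X^n)^(2^n)], converge boundedly to indicators of arcs. *)

(** * Completeness in mean square *)

Section riesz_fischer.
Context d (T : measurableType d) (R : realType) (P : probability T R).
Variable s : nat -> T -> R.
Hypothesis ms : forall k, measurable_fun [set: T] (s k).
Let eps (k : nat) : R := 2^-1 ^+ k.
Hypothesis sE : forall k j, (k <= j)%N ->
  (\int[P]_t ((s j t - s k t) ^+ 2)%:E <= (eps k ^+ 2)%:E)%E.

Let eps_gt0 k : 0 < eps k.
Proof. by rewrite exprn_gt0// invr_gt0. Qed.

Let step k (t : T) : \bar R := `|s k.+1 t - s k t|%:E.

Let mstep k : measurable_fun [set: T] (step k).
Proof.
apply/measurable_EFinP; apply: measurableT_comp => //.
exact: measurable_funB.
Qed.

Let step_ge0 k t : (0 <= step k t)%E.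
Proof. by rewrite lee_fin. Qed.

(* AM-GM with weight [eps k] replaces the Cauchy-Schwarz inequality. *)
Let int_step k : (\int[P]_t step k t <= (eps k)%:E)%E.
Proof.
have e0 := eps_gt0 k.
have msq : measurable_fun [set: T] (fun t => ((s k.+1 t - s k t) ^+ 2)%:E).
  by apply/measurable_EFinP; apply: measurable_funX; exact: measurable_funB.
have le1 : (\int[P]_t step k t <= \int[P]_t ((eps k / 2)%:E +
    ((2 * eps k)^-1)%:E * ((s k.+1 t - s k t) ^+ 2)%:E))%E.
  apply: ge0_le_integral => //.
  - by apply: emeasurable_funD => //; exact: measurable_funeM.
  - move=> t _; rewrite /step -EFinM -EFinD lee_fin.
    rewrite -real_normK ?num_real//; set x := `|_|.
    rewrite -subr_ge0.
    have -> : eps k / 2 + (2 * eps k)^-1 * x ^+ 2 - x =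
              (2 * eps k)^-1 * (x - eps k) ^+ 2.
      by field; rewrite ?gt_eqF.
    by rewrite mulr_ge0 ?sqr_ge0// invr_ge0 mulr_ge0// ltW.
apply: (le_trans le1); rewrite ge0_integralD//; last 3 first.
- by move=> t _; rewrite lee_fin divr_ge0// ltW.
- by move=> t _; rewrite -EFinM lee_fin mulr_ge0 ?sqr_ge0// invr_ge0 mulr_ge0// ltW.
- exact: measurable_funeM.
rewrite [X in (X + _)%E]integral_cst//= (@probability_setT _ _ _ P) mule1.
rewrite ge0_integralZl//; last 2 first.
- by move=> t _; rewrite lee_fin sqr_ge0.
- by rewrite lee_fin invr_ge0 mulr_ge0// ltW.
have -> : (eps k)%:E = ((eps k / 2)%:E + ((2 * eps k)^-1)%:E * (eps k ^+ 2)%:E)%E.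
  by rewrite -EFinM -EFinD; congr EFin; field; rewrite gt_eqF.
rewrite leeD2l// lee_pmul2l//; first exact: sE.
by rewrite lte_fin invr_gt0 mulr_gt0.
Qed.

Let ae_cvg : {ae P, forall t, cvgn (s ^~ t)}.
Proof.
have isum : (\int[P]_t \sum_(0 <= k <oo) step k t < +oo)%E.
  rewrite integral_nneseries//.
  apply: (@le_lt_trans _ _ (\sum_(0 <= k <oo) (eps k)%:E)%E).
    by apply: lee_nneseries => // k _ _; exact: integral_ge0.
  have := @cvg_geometric_series R 1 2^-1.
  rewrite ger0_norm// invf_lt1// ltr1n => /(_ isT) /cvg_lim => ge.
  rewrite (_ : (fun n => \sum_(0 <= k < n) (eps k)%:E)%E =
    EFin \o series (geometric 1 2^-1)); last first.
    apply/funext => n /=; rewrite sumEFin; congr EFin.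
    by apply: eq_bigr => i _; rewrite /eps /= mul1r.
  rewrite EFin_lim ?ltry//; apply: is_cvg_geometric_series.
  by rewrite ger0_norm// invf_lt1// ltr1n.
have mS : measurable_fun [set: T] (fun t => \sum_(0 <= k <oo) step k t)%E.
  exact: ge0_emeasurable_sum.
have S0 t : (0 <= \sum_(0 <= k <oo) step k t)%E by exact: nneseries_ge0.
have iS : P.-integrable [set: T] (fun t => \sum_(0 <= k <oo) step k t)%E.
  apply/integrableP; split => //.
  by under eq_integral do rewrite gee0_abs//.
have := integrable_ae measurableT iS.
apply: filterS => t /(_ I) fS.
have cvs : cvgn (series (telescope (s ^~ t))).
  apply: normed_cvg.
  apply: nondecreasing_is_cvgn.
    by apply/nondecreasing_seqP => n; rewrite -subr_ge0 seriesSB normr_ge0.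
  exists (fine (\sum_(0 <= k <oo) step k t)%E) => _ [n _ <-] /=.
  rewrite -lee_fin fineK// -sumEFin.
  exact: nneseries_lim_ge.
rewrite (_ : s ^~ t = (fun n => s 0 t + series (telescope (s ^~ t)) n)); last first.
  by apply/funext => n; exact: (eq_sum_telescope (s ^~ t)).
by apply: is_cvgD => //; exact: is_cvg_cst.
Qed.

(* The upper limit is measurable whether or not the sequence converges. *)
Let lims (t : T) : R := fine (limn_esup (fun k => (s k t)%:E)).

Let mlims : measurable_fun [set: T] lims.
Proof.
apply: measurableT_comp; first exact: fine_measurable.
by apply: measurable_fun_limn_esup => k; exact/measurable_EFinP.
Qed.

Let limsE t : cvgn (s ^~ t) -> s ^~ t @ \oo --> lims t.
Proof.
move=> ct; rewrite /lims is_cvg_limn_esupE; last first.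
  by apply/cvg_ex; exists (limn (s ^~ t))%:E; apply: cvg_EFin => //; exact: nearW.
by rewrite EFin_lim.
Qed.

(** A sequence that is Cauchy in mean square at a geometric rate converges in
mean square: it converges almost everywhere, because its increments are
summable in mean, and Fatou's lemma bounds the distance to the limit. *)
Lemma riesz_fischer : exists2 f : T -> R, measurable_fun [set: T] f &
  forall k, (\int[P]_t ((f t - s k t) ^+ 2)%:E <= (eps k ^+ 2)%:E)%E.
Proof.
exists lims => // k.
pose g j t : \bar R := ((s (j + k)%N t - s k t) ^+ 2)%:E.
have mg j : measurable_fun [set: T] (g j).
  by apply/measurable_EFinP; apply: measurable_funX; exact: measurable_funB.
have g0 j t : [set: T] t -> (0 <= g j t)%E by rewrite lee_fin sqr_ge0.
rewrite (@ge0_ae_eq_integral _ _ _ _ _ _ (fun t => limn_einf (g ^~ t))) //=.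
- apply: (le_trans (fatou P measurableT mg g0)).
  apply: (le_trans (limn_einf_sup _)).
  rewrite limn_esup_lim; apply: lime_le.
    exact: is_cvg_esups.
  apply: nearW => n; apply: ge_ereal_sup => _ [j _ <-].
  by apply: sE; rewrite leq_addl.
- by apply/measurable_EFinP; apply: measurable_funX; exact: measurable_funB.
- apply: (measurableT_comp (@oppe_measurable _ _)).
  apply: measurable_fun_limn_esup => j.
  exact: (measurableT_comp (@oppe_measurable _ _)).
- by move=> t _; rewrite lee_fin sqr_ge0.
- move=> t _; rewrite limn_einf_lim; apply: lime_ge.
    exact: is_cvg_einfs.
  by apply: nearW => n; apply: le_ereal_inf_tmp => _ [j _ <-]; exact: g0.
- apply: filterS ae_cvg => t ct _.
  have cg : g ^~ t @ \oo --> ((lims t - s k t) ^+ 2)%:E.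
    apply: cvg_EFin; first exact: nearW.
    rewrite /comp/=.
    have -> : (fun j => fine (g j t)) =
        (fun j => (s (j + k)%N t - s k t) * (s (j + k)%N t - s k t)) by [].
    have c1 : (fun j => s (j + k)%N t - s k t) @ \oo --> lims t - s k t.
      by apply: cvgB; [rewrite (cvg_shiftn k (s ^~ t)); exact: limsE|exact: cvg_cst].
    by rewrite expr2; exact: cvgM.
  by rewrite is_cvg_limn_einfE; [exact/esym/cvg_lim|apply/cvg_ex; eexists; exact: cg].
Qed.

End riesz_fischer.

(** * Functions determined by their integrals over half-lines *)

Section ray_uniqueness.
Context (R : realType) (P : probability (measurableTypeR R) R).

Lemma integral_setC_eq0 (g : measurableTypeR R -> R) A : measurable A ->
  P.-integrable setT (EFin \o g) -> (\int[P]_t (g t)%:E = 0)%E ->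
  (\int[P]_(t in A) (g t)%:E = 0)%E -> (\int[P]_(t in ~` A) (g t)%:E = 0)%E.
Proof.
move=> mA ig gT gA; rewrite -gT -[in RHS](setvU A) setUC.
rewrite integral_setU //; last 3 first.
- exact: measurableC.
- by rewrite setUCr; case/integrableP : ig.
- by apply/disj_set2P; rewrite setICr.
by rewrite gA add0e.
Qed.

(** The half-lines are stable under intersection and generate the Borel sets, so
Dynkin's lemma extends the hypothesis to all measurable sets. *)
Lemma ae_eq0_ray (g : measurableTypeR R -> R) :
  P.-integrable setT (EFin \o g) -> (\int[P]_t (g t)%:E = 0)%E ->
  (forall x, \int[P]_(t in `]x, +oo[%classic) (g t)%:E = 0)%E ->
  {ae P, forall t, g t = 0}.
Proof.
move=> ig gT gx.
have key : forall A, measurable A -> (\int[P]_(t in A) (g t)%:E = 0)%E.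
  move=> A mA.
  apply: (@dynkin_induction _ (measurableTypeR R) (@RGenOInfty.G R)
    (fun A => \int[P]_(t in A) (g t)%:E = 0)%E) => //.
  - exact: RGenOInfty.measurableE.
  - move=> _ _ [x ->] [y ->]; exists (Num.max x y).
    by apply/seteqP; split => t /=; rewrite !in_itv/= !andbT gt_max => /andP.
  - by move=> _ [x ->]; exact: gx.
  - by move=> S mS; exact: integral_setC_eq0.
  - move=> F mF tF F0; rewrite integral_bigcup//.
      by apply: eseries0 => i _ _; exact: F0.
    by apply: integrableS ig => //; exact: bigcupT_measurable.
  - have <- // : @measurable _ (measurableTypeR R) = <<s @RGenOInfty.G R >>.
    exact: RGenOInfty.measurableE.
have : ae_eq P setT (EFin \o g) (EFin \o cst 0).
  apply: (integral_ae_eq measurableT ig); first exact: measurableT_comp.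
  move=> E _ mE.
  by rewrite key//; apply/esym/integral0_eq.
by move=> h; apply: filterS h => t /(_ I) gt; exact: EFin_inj.
Qed.

End ray_uniqueness.

(** * Polynomials approximating a step *)

Section step_polynomials.
Context (R : realType).
Implicit Types u : R.

(** These polynomials, used in proofs of the Stone-Weierstrass theorem, converge on
the unit interval to the indicator of the points below one half. *)
Definition step_poly n : {poly R} := (1 - 'X^n) ^+ (2 ^ n).

Lemma step_polyE n u : (step_poly n).[u] = (1 - u ^+ n) ^+ (2 ^ n).
Proof. by rewrite /step_poly horner_exp !hornerE. Qed.

Lemma step_poly_bound n u : 0 <= u <= 1 -> 0 <= (step_poly n).[u] <= 1.
Proof.
move=> /andP[u0 u1]; rewrite step_polyE.
have un1 : u ^+ n <= 1 by exact: exprn_ile1.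
by rewrite exprn_ge0 ?subr_ge0// exprn_ile1 ?subr_ge0// gerBl exprn_ge0.
Qed.

Lemma bernoulli_expr (x : R) m : -1 <= x -> 1 + m%:R * x <= (1 + x) ^+ m.
Proof.
move=> x1; elim: m => [|m IH]; first by rewrite expr0 mul0r addr0.
rewrite exprS; apply: (@le_trans _ _ ((1 + x) * (1 + m%:R * x))); last first.
  by rewrite ler_wpM2l// -lerBlDl sub0r.
rewrite -subr_ge0 -natr1.
rewrite (_ : _ - _ = m%:R * x ^+ 2); last by ring.
by rewrite mulr_ge0// sqr_ge0.
Qed.

(** Bernoulli's inequality bounds the polynomial below by [1 - (2 u)^n]. *)
Lemma step_poly_lt u : 0 <= u -> u < 2^-1 ->
  (step_poly n).[u] @[n --> \oo] --> (1 : R).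
Proof.
move=> u0 u2.
have v1 : `|2 * u| < 1 by rewrite ger0_norm ?mulr_ge0//; lra.
apply: (@squeeze_cvgr _ _ _ _ (fun n => 1 - (2 * u) ^+ n) (fun=> 1)).
- apply: nearW => n; apply/andP; split; last first.
    by have /andP[] := @step_poly_bound n u ltac:(by apply/andP; split => //; lra).
  rewrite step_polyE.
  have := @bernoulli_expr (- u ^+ n) (2 ^ n).
  rewrite lerN2 exprn_ile1 //; last by lra.
  by move=> /(_ isT); rewrite mulrN natrX -exprMn.
- rewrite -[X in _ --> X]subr0; apply: cvgB; first exact: cvg_cst.
  exact: cvg_expr.
- exact: cvg_cst.
Qed.

(** Multiplication by [(1 + u^n)^(2^n)], which Bernoulli's inequality bounds below
by [(2 u)^n], gives a value at most one. *)
Lemma step_poly_gt u : 2^-1 < u -> u < 1 ->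
  (step_poly n).[u] @[n --> \oo] --> (0 : R).
Proof.
move=> u2 u1.
have u0 : 0 < u by lra.
have v1 : `|(2 * u)^-1| < 1.
  rewrite ger0_norm ?invr_ge0 ?mulr_ge0// 1?ltW//.
  by rewrite invf_lt1 ?mulr_gt0//; lra.
apply: (@squeeze_cvgr _ _ _ _ (fun=> 0) (fun n => (2 * u)^-1 ^+ n)).
- apply: nearW => n; apply/andP; split.
    by have /andP[] := @step_poly_bound n u ltac:(by apply/andP; split; lra).
  rewrite step_polyE exprVn -[leRHS]mul1r ler_pdivlMr ?exprn_gt0 ?mulr_gt0//.
  have un0 : 0 <= u ^+ n by rewrite exprn_ge0// ltW.
  have un1 : u ^+ n <= 1 by rewrite exprn_ile1// ltW.
  apply: (@le_trans _ _ ((1 - u ^+ n) ^+ (2 ^ n) * (1 + u ^+ n) ^+ (2 ^ n))).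
    rewrite ler_wpM2l// ?exprn_ge0 ?subr_ge0//.
    have := @bernoulli_expr (u ^+ n) (2 ^ n) ltac:(lra).
    rewrite natrX -exprMn => H; apply: (le_trans _ H).
    by rewrite lerDr.
  rewrite -exprMn (_ : (1 - u ^+ n) * (1 + u ^+ n) = 1 - (u ^+ n) ^+ 2); last by ring.
  apply: exprn_ile1; first by rewrite subr_ge0 exprn_ile1.
  by rewrite gerBl exprn_ge0.
- exact: cvg_cst.
- exact: cvg_expr.
Qed.

End step_polynomials.

(** * Complex integration on the circle *)

Section complex_parts.
Context (R : realType).
Implicit Types x y : R[i].
Local Open Scope complex_scope.

Lemma ReD x y : complex.Re (x + y) = complex.Re x + complex.Re y.
Proof. by case: x y => [a b] [c d]. Qed.

Lemma ImD x y : complex.Im (x + y) = complex.Im x + complex.Im y.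
Proof. by case: x y => [a b] [c d]. Qed.

Lemma ReB x y : complex.Re (x - y) = complex.Re x - complex.Re y.
Proof. by case: x y => [a b] [c d]. Qed.

Lemma ImB x y : complex.Im (x - y) = complex.Im x - complex.Im y.
Proof. by case: x y => [a b] [c d]. Qed.

Lemma ReM x y : complex.Re (x * y) =
  complex.Re x * complex.Re y - complex.Im x * complex.Im y.
Proof. by case: x y => [a b] [c d]. Qed.

Lemma ImM x y : complex.Im (x * y) =
  complex.Re x * complex.Im y + complex.Im x * complex.Re y.
Proof. by case: x y => [a b] [c d]. Qed.

Lemma ReC x : complex.Re x^*%C = complex.Re x.
Proof. by case: x. Qed.

Lemma ImC x : complex.Im x^*%C = - complex.Im x.
Proof. by case: x. Qed.

Lemma complex_ext x y : complex.Re x = complex.Re y ->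
  complex.Im x = complex.Im y -> x = y.
Proof. by case: x y => [a b] [c d] /= -> ->. Qed.

Lemma conjcD x y : (x + y)^*%C = x^*%C + y^*%C.
Proof. exact: rmorphD. Qed.

Lemma conjcB x y : (x - y)^*%C = x^*%C - y^*%C.
Proof. exact: rmorphB. Qed.

Lemma conjcN x : (- x)^*%C = - x^*%C.
Proof. exact: rmorphN. Qed.

Lemma conjcM x y : (x * y)^*%C = x^*%C * y^*%C.
Proof. exact: rmorphM. Qed.

Lemma normcE_ReIm x :
  Normc.normc x = Num.sqrt (complex.Re x ^+ 2 + complex.Im x ^+ 2).
Proof. by case: x. Qed.

Lemma normc_ge0 x : 0 <= Normc.normc x.
Proof. by case: x => a b; exact: sqrtr_ge0. Qed.

Lemma normc_sqr x : Normc.normc x ^+ 2 = complex.Re x ^+ 2 + complex.Im x ^+ 2.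
Proof. by rewrite normcE_ReIm sqr_sqrtr// addr_ge0 ?sqr_ge0. Qed.

Lemma mulc_conj x : x * x^*%C = (Normc.normc x ^+ 2)%:C.
Proof.
rewrite normc_sqr; apply: complex_ext; rewrite ?ReM ?ImM ReC ImC /=.
  by rewrite mulrN opprK -!expr2.
by rewrite mulrN mulrC addNr.
Qed.

Lemma ler_normRe x : `|complex.Re x| <= Normc.normc x.
Proof. by rewrite normcE_ReIm -sqrtr_sqr ler_wsqrtr// lerDl sqr_ge0. Qed.

Lemma ler_normIm x : `|complex.Im x| <= Normc.normc x.
Proof. by rewrite normcE_ReIm -sqrtr_sqr ler_wsqrtr// lerDr sqr_ge0. Qed.

Lemma normc_conj x : Normc.normc x^*%C = Normc.normc x.
Proof. by rewrite !normcE_ReIm ReC ImC sqrrN. Qed.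

Lemma normc_real (r : R) : Normc.normc r%:C = `|r|.
Proof. by rewrite normcE_ReIm /= expr0n addr0 sqrtr_sqr. Qed.

End complex_parts.

Section complex_integral.
Context (R : realType).
Local Open Scope complex_scope.
Local Notation mu := (circle_measure R).
Implicit Types (f g h : R -> R[i]).

Definition cintegrable f : Prop :=
  mu.-integrable setT (fun t => (complex.Re (f t))%:E) /\
  mu.-integrable setT (fun t => (complex.Im (f t))%:E).

Lemma cmeasurableM f g : cmeasurable f -> cmeasurable g ->
  cmeasurable (fun t => f t * g t).
Proof.
move=> [fr fi] [gr gi]; split.
  under eq_fun do rewrite ReM.
  by apply: measurable_funB; exact: measurable_funM.
under eq_fun do rewrite ImM.
by apply: measurable_funD; exact: measurable_funM.
Qed.

Lemma cmeasurable_conj f : cmeasurable f -> cmeasurable (fun t => (f t)^*%C).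
Proof.
move=> [fr fi]; split; first by under eq_fun do rewrite ReC.
by under eq_fun do rewrite ImC; exact: measurableT_comp.
Qed.

Lemma cmeasurable_cst (c : R[i]) : cmeasurable (fun=> c).
Proof. by split; exact: measurable_cst. Qed.

Lemma cmeasurable_real (p : R -> R) : measurable_fun [set: measurableTypeR R] p ->
  cmeasurable (fun t => (p t)%:C).
Proof. by move=> mp; split => //; exact: measurable_cst. Qed.

Lemma cintegrable_measurable f : cintegrable f -> cmeasurable f.
Proof.
by move=> [/integrableP[/measurable_EFinP ? _] /integrableP[/measurable_EFinP ? _]].
Qed.

Lemma cintegrableD f g : cintegrable f -> cintegrable g ->
  cintegrable (fun t => f t + g t).
Proof.
move=> [fr fi] [gr gi]; split.
  by under eq_fun do rewrite ReD EFinD; exact: integrableD.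
by under eq_fun do rewrite ImD EFinD; exact: integrableD.
Qed.

Lemma cintegrable_conj f : cintegrable f -> cintegrable (fun t => (f t)^*%C).
Proof.
move=> [fr fi]; split; first by under eq_fun do rewrite ReC.
by under eq_fun do rewrite ImC EFinN; exact: integrableN.
Qed.

Lemma cintegrableM_bounded f h (M : R) : cmeasurable h ->
  (forall t, Normc.normc (h t) <= M) -> cintegrable f ->
  cintegrable (fun t => f t * h t).
Proof.
move=> [hr hi] hM [fr fi].
have bnd (k : R -> R) : (forall t, `|k t| <= M) ->
    [bounded k t | t in [set: measurableTypeR R]].
  move=> kM; exists M; split; first exact: num_real.
  by move=> x Mx t _; exact: (le_trans (kM t) (ltW Mx)).
have bRe : [bounded complex.Re (h t) | t in [set: measurableTypeR R]].
  apply: (bnd (fun t => complex.Re (h t))) => t.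
  exact: (le_trans (ler_normRe _) (hM t)).
have bIm : [bounded complex.Im (h t) | t in [set: measurableTypeR R]].
  apply: (bnd (fun t => complex.Im (h t))) => t.
  exact: (le_trans (ler_normIm _) (hM t)).
split.
  under eq_fun do rewrite ReM EFinB !EFinM.
  by apply: integrableB => //; exact: integrableMl.
under eq_fun do rewrite ImM EFinD !EFinM.
by apply: integrableD => //; exact: integrableMl.
Qed.

Lemma cintegrableZ (a : R[i]) f : cintegrable f -> cintegrable (fun t => a * f t).
Proof.
under [fun t => a * _]eq_fun do rewrite mulrC.
exact: (@cintegrableM_bounded f (fun=> a) (Normc.normc a) (cmeasurable_cst a)).
Qed.

Lemma cintegralD f g : cintegrable f -> cintegrable g ->
  cintegral (fun t => f t + g t) = cintegral f + cintegral g.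
Proof.
move=> [fr fi] [gr gi]; rewrite /cintegral.
under eq_Rintegral do rewrite ReD.
rewrite RintegralD//.
under [X in _ +i* X]eq_Rintegral do rewrite ImD.
by rewrite RintegralD.
Qed.

Lemma cintegralZ (a : R[i]) f : cintegrable f ->
  cintegral (fun t => a * f t) = a * cintegral f.
Proof.
case: a => a b [fr fi]; rewrite /cintegral.
under eq_Rintegral do rewrite ReM /=.
rewrite RintegralB//; last 2 first.
- by rewrite /comp; under eq_fun do rewrite EFinM; exact: integrableZl.
- by rewrite /comp; under eq_fun do rewrite EFinM; exact: integrableZl.
rewrite !RintegralZl//.
under [X in _ +i* X]eq_Rintegral do rewrite ImM /=.
rewrite RintegralD//; last 2 first.
- by rewrite /comp; under eq_fun do rewrite EFinM; exact: integrableZl.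
- by rewrite /comp; under eq_fun do rewrite EFinM; exact: integrableZl.
by rewrite !RintegralZl.
Qed.

Lemma cintegral_conj f : cintegrable f ->
  cintegral (fun t => (f t)^*%C) = (cintegral f)^*%C.
Proof.
move=> [fr fi]; rewrite /cintegral /=.
under eq_Rintegral do rewrite ReC.
congr (_ +i* _); rewrite -[RHS]mulN1r -RintegralZl//.
by apply: eq_Rintegral => t _; rewrite ImC mulN1r.
Qed.

Lemma eq_cintegral f g : f =1 g -> cintegral f = cintegral g.
Proof. by move=> /funext ->. Qed.

Lemma cintegral_ae_eq f g : cmeasurable f -> cmeasurable g ->
  {ae mu, forall t : measurableTypeR R, f t = g t} -> cintegral f = cintegral g.
Proof.
move=> [fr fi] [gr gi] fg; rewrite /cintegral /Rintegral.
congr (fine _ +i* fine _); apply: ae_eq_integral => //.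
- exact/measurable_EFinP.
- exact/measurable_EFinP.
- by apply: filterS fg => t /= -> _.
- exact/measurable_EFinP.
- exact/measurable_EFinP.
- by apply: filterS fg => t /= -> _.
Qed.

End complex_integral.

Section coordinate_function.
Context (R : realType).
Local Open Scope complex_scope.
Local Notation z := (@zfun R).
Implicit Types (t : R) (n m : int).

Lemma zfun_conj t : (z t)^*%C = (z t)^-1.
Proof.
have zz : z t * (z t)^*%C = 1.
  apply: complex_ext; rewrite ?ReM ?ImM /=; last by rewrite mulrC; ring.
  by rewrite mulrN opprK -!expr2 cos2Dsin2.
have z0 : z t != 0.
  by apply/eqP => z0; move: zz; rewrite z0 mul0r => /esym/eqP; rewrite oner_eq0.
by rewrite -[LHS](mulKf z0) zz mulr1.
Qed.

Lemma zfun_neq0 t : z t != 0.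
Proof.
apply/eqP => z0; have := zfun_conj t; have := cos2Dsin2 t.
by case: z0 => -> ->; rewrite expr0n addr0 => /eqP; rewrite eq_sym oner_eq0.
Qed.

Lemma zfunX_conj t n : (z t ^ n)^*%C = z t ^ (- n).
Proof.
rewrite -exprz_inv -zfun_conj.
by case: n => n; rewrite /exprz ?fmorphV rmorphXn.
Qed.

Lemma zfunD t n m : z t ^ (n + m) = z t ^ n * z t ^ m.
Proof. by rewrite expfzDr// zfun_neq0. Qed.

Lemma normc_zfunX t n : Normc.normc (z t ^ n) = 1.
Proof.
apply/eqP; rewrite -sqrp_eq1 ?normc_ge0//.
rewrite expr2 -{2}normc_conj -Normc.normcM zfunX_conj -zfunD subrr expr0z.
by rewrite Normc.normc1.
Qed.

Lemma measurable_zfunX n : cmeasurable (fun t => z t ^ n).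
Proof.
have mz : cmeasurable z.
  by split; apply: continuous_measurable_fun;
    [exact: continuous_cos|exact: continuous_sin].
have mX k : cmeasurable (fun t => z t ^+ k).
  elim: k => [|k IH]; first exact: cmeasurable_cst.
  by under eq_fun do rewrite exprS; exact: cmeasurableM.
case: n => n; first exact: mX.
have -> : (fun t => z t ^ Negz n) = (fun t => (z t ^+ n.+1)^*%C).
  by apply/funext => t; rewrite -[z t ^+ _]/(z t ^ n.+1) zfunX_conj NegzE.
exact/cmeasurable_conj/mX.
Qed.

End coordinate_function.

(** * Totality of the powers of the coordinate function *)

Section circle_support.
Context (R : realType).
Local Notation mu := (circle_measure R).

Lemma ae_neq_point (a : R) : {ae mu, forall t : measurableTypeR R, t != a}.
Proof.
exists [set a]; split => //.
- have /null_content_dominatesP := dominates_uniform_prob (twopi_gt0 R).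
  by apply; [exact: measurable_set1|exact: lebesgue_measure_set1].
- by move=> t /= /negP; rewrite negbK => /eqP.
Qed.

Lemma ae_circle : {ae mu, forall t : measurableTypeR R, 0 < t < pi *+ 2}.
Proof.
have h : {ae mu, forall t : measurableTypeR R, 0 <= t <= pi *+ 2}.
  exists (~` `[0, pi *+ 2]%classic); split.
  - by apply: measurableC.
  - rewrite /mu/= /circle_measure/= /uniform_prob integral_uniform_pdf.
    by rewrite setICl integral_set0.
  - by move=> t /= h1; rewrite in_itv/= => h2; apply: h1.
apply: filterS3 h (ae_neq_point 0) (ae_neq_point (pi *+ 2)) => t /andP[t0 t2] n0 n2.
by rewrite !lt_neqAle t0 t2 eq_sym n0 n2.
Qed.

End circle_support.

Section totality.
Context (R : realType).
Local Open Scope complex_scope.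
Local Notation mu := (circle_measure R).
Local Notation z := (@zfun R).
Variable f : R -> R[i].
Hypothesis intf : cintegrable f.
Hypothesis f0 : forall n : int, cintegral (fun t => f t * z t ^ n) = 0.

(* The bounded functions [p] such that [p f], like [f], has no Fourier
   coefficients; they include the polynomials in a cosine ([K_poly]). *)
Let K (p : R -> R) : Prop :=
  [/\ measurable_fun [set: measurableTypeR R] p, (exists M, forall t, `|p t| <= M) &
      forall n : int, cintegral (fun t => f t * ((p t)%:C * z t ^ n)) = 0].

Let intK p (n : int) : K p -> cintegrable (fun t => f t * ((p t)%:C * z t ^ n)).
Proof.
move=> [mp [M pM] _]; apply: (@cintegrableM_bounded _ _ _ M) => //.
  by apply: cmeasurableM; [exact: cmeasurable_real|exact: measurable_zfunX].
by move=> t; rewrite Normc.normcM normc_zfunX mulr1 normc_real.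
Qed.

Let K_cst (c : R) : K (fun=> c).
Proof.
split; [exact: measurable_cst|by exists `|c| |move=> n].
rewrite (_ : (fun t => _) = (fun t => c%:C * (f t * z t ^ n))); last first.
  by apply/funext => t; rewrite mulrCA.
rewrite cintegralZ ?f0 ?mulr0//.
apply: (@cintegrableM_bounded _ _ _ 1) => //; first exact: measurable_zfunX.
by move=> t; rewrite normc_zfunX.
Qed.

Let K_add p q : K p -> K q -> K (fun t => p t + q t).
Proof.
move=> Kp Kq; have [mp [M pM] p0] := Kp; have [mq [N qN] q0] := Kq; split.
- exact: measurable_funD.
- by exists (M + N) => t; rewrite (le_trans (ler_normD _ _))// lerD.
move=> n; rewrite -[RHS]addr0 -{1}(p0 n) -(q0 n) -cintegralD; [|exact: intK..].
by apply: eq_cintegral => t; rewrite rmorphD mulrDl mulrDr.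
Qed.

Let cos_zfun (tau t : R) : (cos (t - tau))%:C =
  (cos tau -i* sin tau) / 2%:R * z t ^ 1 + (cos tau +i* sin tau) / 2%:R * z t ^ (-1).
Proof.
rewrite -[-1]/(- 1%:Z) -zfunX_conj expr1z cosB.
have -> : (2%:R : R[i])^-1 = (2^-1)%:C by rewrite fmorphV rmorph_nat.
by apply: complex_ext; rewrite /zfun /=; field.
Qed.

Let K_cos p (ka la tau : R) : K p -> K (fun t => p t * (ka + la * cos (t - tau))).
Proof.
move=> Kp; have [mp [M pM] p0] := Kp; split.
- apply: measurable_funM => //; apply: measurable_funD => //.
  apply: measurable_funM => //.
  apply: (measurableT_comp (continuous_measurable_fun (@continuous_cos R))).
  exact: measurable_funB.
- exists (M * (`|ka| + `|la|)) => t; rewrite normrM ler_pM//.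
  rewrite (le_trans (ler_normD _ _))// lerD2l normrM ler_piMr//.
  by rewrite ler_norml cos_geN1 cos_le1.
move=> n; set w1 := (cos tau -i* sin tau) / 2%:R.
pose w2 := (cos tau +i* sin tau) / 2%:R.
rewrite (_ : (fun t => _) = (fun t => ka%:C * (f t * ((p t)%:C * z t ^ n)) +
   (la%:C * w1 * (f t * ((p t)%:C * z t ^ (n + 1))) +
    la%:C * w2 * (f t * ((p t)%:C * z t ^ (n - 1)))))); last first.
  apply/funext => t; rewrite rmorphM rmorphD rmorphM /= cos_zfun.
  rewrite -/w1 -/w2 !zfunD; ring.
rewrite !cintegralD ?cintegralZ ?p0 ?mulr0 ?addr0//; try exact: intK;
  repeat first [exact: intK | apply: cintegrableZ | apply: cintegrableD].
Qed.

Let K_poly (P : {poly R}) (ka la tau : R) :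
  K (fun t => P.[ka + la * cos (t - tau)]).
Proof.
elim/poly_ind: P => [|P c IH].
  by under [fun _ => _]eq_fun do rewrite horner0; exact: K_cst.
under [fun _ => _]eq_fun do rewrite hornerMXaddC.
by apply: K_add; [exact: K_cos|exact: K_cst].
Qed.

Let int_real (p : R -> R) : K p ->
  (\int[mu]_t (complex.Re (f t) * p t)%:E = 0 /\
   \int[mu]_t (complex.Im (f t) * p t)%:E = 0)%E.
Proof.
move=> Kp; have [mp [M pM] p0] := Kp.
have ip : cintegrable (fun t => f t * (p t)%:C).
  have := intK 0 Kp; congr cintegrable; apply/funext => t.
  by rewrite expr0z mulr1.
have : cintegral (fun t => f t * (p t)%:C) = 0.
  by rewrite -(p0 0); apply: eq_cintegral => t; rewrite expr0z mulr1.
have [ir ii] := ip.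
have eR : (fun t => (complex.Re (f t) * p t)%:E) =
          (fun t => (complex.Re (f t * (p t)%:C))%:E).
  by apply/funext => t; rewrite ReM /= mulr0 subr0.
have eI : (fun t => (complex.Im (f t) * p t)%:E) =
          (fun t => (complex.Im (f t * (p t)%:C))%:E).
  by apply/funext => t; rewrite ImM /= mulr0 add0r.
rewrite /cintegral /Rintegral => -[h1 h2]; rewrite eR eI.
by split; rewrite -[LHS]fineK ?h1 ?h2//; exact: integrable_fin_num.
Qed.

(* On the interval from [0] to [2 pi] this is positive after [a] and negative
   before it, because of the factorization below. *)
Let arc (a t : R) := cos (a / 2) - cos (t - a / 2).

Let arcE a t : arc a t = 2 * sin (t / 2) * sin ((t - a) / 2).
Proof.
rewrite /arc.
have -> : a / 2 = t / 2 - (t - a) / 2 by field.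
have -> : t - (t / 2 - (t - a) / 2) = t / 2 + (t - a) / 2 by field.
by rewrite cosB cosD; ring.
Qed.

Let sin_half_gt0 (t : R) : 0 < t -> t < pi *+ 2 -> 0 < sin (t / 2).
Proof.
move=> t0 t2; apply: sin_gt0_pi; rewrite divr_gt0//=.
by rewrite ltr_pdivrMr// mulr_natr.
Qed.

Let arc_gt0 a t : 0 <= a -> a < t < pi *+ 2 -> 0 < arc a t.
Proof.
move=> a0 /andP[at_ t2]; have t0 := le_lt_trans a0 at_.
rewrite arcE mulr_gt0 ?mulr_gt0 ?sin_half_gt0 ?subr_gt0//.
by rewrite (le_lt_trans _ t2)// gerBl.
Qed.

Let arc_lt0 a t : 0 < t < a -> a <= pi *+ 2 -> arc a t < 0.
Proof.
move=> /andP[t0 ta] a2; have t2 := lt_le_trans ta a2.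
rewrite arcE -oppr_gt0 -mulrN -sinN -mulNr opprB.
rewrite mulr_gt0 ?mulr_gt0 ?sin_half_gt0 ?subr_gt0//.
by rewrite (lt_le_trans _ a2)// gtrBl.
Qed.

(* The factor [1 / 5] keeps the values inside the unit interval. *)
Let u (a t : R) := (2^-1 - cos (a / 2) / 5) + 5^-1 * cos (t - a / 2).

Let uE a t : u a t = 2^-1 - arc a t / 5.
Proof. by rewrite /u /arc; field. Qed.

Let u01 a t : 0 <= u a t < 1.
Proof.
have := cos_geN1 (a / 2); have := cos_le1 (a / 2).
have := cos_geN1 (t - a / 2); have := cos_le1 (t - a / 2).
by rewrite /u; move: (cos _) (cos _) => c1 c2 *; apply/andP; split; lra.
Qed.

Let step_cvg a t : 0 <= a <= pi *+ 2 -> 0 < t < pi *+ 2 -> t != a ->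
  (step_poly R n).[u a t] @[n --> \oo] --> ((a < t)%R%:R : R).
Proof.
move=> /andP[a0 a2] /andP[t0 t2] ta; have /andP[u0 u1] := u01 a t.
have := ta; rewrite neq_lt => /orP[lt|lt].
  rewrite ltNge (ltW lt)/=.
  have h : arc a t < 0 by apply: arc_lt0; rewrite ?t0.
  by apply: step_poly_gt => //; rewrite uE; lra.
rewrite lt; have h : 0 < arc a t by apply: arc_gt0; rewrite ?lt.
by apply: step_poly_lt => //; rewrite uE; lra.
Qed.

Let ray_int (g : measurableTypeR R -> R) : mu.-integrable setT (EFin \o g) ->
  (forall P ka la tau,
     \int[mu]_t (g t * P.[ka + la * cos (t - tau)])%:E = 0)%E ->
  forall x, (\int[mu]_(t in `]x, +oo[%classic) (g t)%:E = 0)%E.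
Proof.
(* Outside the interval of integration the half-line can be moved to an end. *)
move=> ig gP x; pose a := Num.max 0 (Num.min x (pi *+ 2)).
have a02 : 0 <= a <= pi *+ 2.
  by rewrite /a le_max lexx /= ge_max ltW ?twopi_gt0//= ge_min lexx orbT.
have /measurable_EFinP mg := measurable_int _ ig.
have mray : measurable_fun [set: measurableTypeR R] (fun t : R => (x < t)%R%:R : R).
  rewrite (_ : (fun t => _) = \1_(`]x, +oo[%classic)).
    exact: measurable_indic.
  by apply/funext => t; rewrite indicE mem_setE in_itv/= andbT.
have mpoly n : measurable_fun [set: measurableTypeR R]
    (fun t : R => (step_poly R n).[u a t]).
  by have [] := K_poly (step_poly R n) (2^-1 - cos (a / 2) / 5) 5^-1 (a / 2).
have [_ _ lim0] : [/\ mu.-integrable setT (fun t => (g t * (x < t)%R%:R)%:E),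
  [sequence \int[mu]_t `|(g t * (step_poly R n).[u a t])%:E
                          - (g t * (x < t)%R%:R)%:E|]_n%E @ \oo --> 0%E &
  [sequence \int[mu]_t (g t * (step_poly R n).[u a t])%:E]_n%E @ \oo -->
    (\int[mu]_t (g t * (x < t)%R%:R)%:E)%E].
  apply: (@dominated_convergence _ _ _ mu setT measurableT _ _
    (fun t => `|(g t)%:E|%E)).
  - by move=> n; apply/measurable_EFinP; exact: measurable_funM.
  - by apply/measurable_EFinP; exact: measurable_funM.
  - apply: filterS2 (ae_circle R) (ae_neq_point a) => t t02 ta _.
    apply: cvg_EFin; first exact: nearW.
    rewrite /comp/=; apply: cvgM; first exact: cvg_cst.
    have := step_cvg a02 t02 ta; congr (_ --> _); congr (_%:R).
    have /andP[t0 t2] := t02.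
    by rewrite /a gt_max t0/= gt_min [pi *+ 2 < t]ltNge (ltW t2) orbF.
  - exact: integrable_abse.
  - apply: aeW => t n _; rewrite lee_fin normrM ler_piMr//.
    have /andP[u0 u1] := u01 a t.
    have /andP[s0 s1] : 0 <= (step_poly R n).[u a t] <= 1.
      by apply: step_poly_bound; rewrite u0 ltW.
    by rewrite ger0_norm.
have {}lim0 : (\int[mu]_t (g t * (x < t)%R%:R)%:E)%E = 0%E.
  rewrite -(cvg_lim _ lim0)//; apply: lim_near_cst => //; apply: nearW => n.
  exact: gP.
rewrite -[RHS]lim0 integral_mkcond; apply: eq_integral => t _.
rewrite patchE mem_setE in_itv/= andbT; case: ifPn => _; first by rewrite mulr1.
by rewrite mulr0.
Qed.

(** The real and imaginary parts of [f] integrate to zero against polynomials in a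
cosine, hence by dominated convergence over every half-line. *)
Lemma zfun_total : {ae mu, forall t : measurableTypeR R, f t = 0}.
Proof.
have [ir ii] := intf.
have hRe : {ae mu, forall t : measurableTypeR R, complex.Re (f t) = 0}.
  apply: ae_eq0_ray => //.
    have [+ _] := int_real (K_cst 1).
    by under eq_integral do rewrite mulr1.
  apply: ray_int => // P ka la tau.
  by have [] := int_real (K_poly P ka la tau).
have hIm : {ae mu, forall t : measurableTypeR R, complex.Im (f t) = 0}.
  apply: ae_eq0_ray => //.
    have [_ +] := int_real (K_cst 1).
    by under eq_integral do rewrite mulr1.
  apply: ray_int => // P ka la tau.
  by have [] := int_real (K_poly P ka la tau).
by apply: filterS2 hRe hIm => t r i; apply: complex_ext.
Qed.

End totality.

(** * Square-integrable functions and their classes *)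

Section square_integrable.
Context (R : realType).
Local Open Scope complex_scope.
Local Notation mu := (circle_measure R).
Implicit Types (f g h : R -> R[i]).

Lemma cLfun2P f : cLfun 2%:E f <-> cmeasurable f /\
  (\int[mu]_t (Normc.normc (f t) ^+ 2)%:E < +oo)%E.
Proof.
split => [[mf /Lfun2_integrable_sqr/integrableP[_ lt]]|[mf lt]]; split => //.
  apply: le_lt_trans lt; rewrite le_eqVlt; apply/orP; left; apply/eqP.
  by apply: eq_integral => t _ /=; rewrite ger0_norm// sqr_ge0.
rewrite inE; apply/andP; split; rewrite inE/=; first exact: cmeasurable_normc.
rewrite /finite_norm unlock /Lnorm poweR_lty//.
apply: le_lt_trans lt; rewrite le_eqVlt; apply/orP; left; apply/eqP.
apply: eq_integral => t _ /=.
by rewrite powR_mulrn// real_normK ?num_real.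
Qed.

Lemma cLfun2_le f g (M : R) : cmeasurable g -> cLfun 2%:E f ->
  {ae mu, forall t : measurableTypeR R, Normc.normc (g t) <= M * Normc.normc (f t)} ->
  cLfun 2%:E g.
Proof.
move=> mg /cLfun2P[mf lt] gf; apply/cLfun2P; split => //.
have mn h : cmeasurable h ->
    measurable_fun [set: measurableTypeR R] (fun t => (Normc.normc (h t) ^+ 2)%:E).
  move=> mh; apply/measurable_EFinP; apply: measurable_funX.
  exact: cmeasurable_normc.
apply: (@le_lt_trans _ _ (\int[mu]_t ((M ^+ 2)%:E * (Normc.normc (f t) ^+ 2)%:E))%E).
  apply: ae_ge0_le_integral => //.
  - by move=> t _; rewrite lee_fin sqr_ge0.
  - exact: mn.
  - by move=> t _; rewrite -EFinM lee_fin mulr_ge0 ?sqr_ge0.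
  - by apply: measurable_funeM; exact: mn.
  - apply: filterS gf => t gt _; rewrite -EFinM lee_fin -exprMn.
    rewrite lerXn2r ?nnegrE ?normc_ge0//.
    exact: le_trans (normc_ge0 _) gt.
rewrite ge0_integralZl//; last 3 first.
- exact: mn.
- by move=> t _; rewrite lee_fin sqr_ge0.
- by rewrite lee_fin sqr_ge0.
by rewrite lte_mul_pinfty ?lee_fin ?sqr_ge0.
Qed.

Lemma cLfun2_ae_eq f g : cmeasurable g -> cLfun 2%:E f ->
  {ae mu, forall t : measurableTypeR R, f t = g t} -> cLfun 2%:E g.
Proof.
move=> mg cf fg; apply: (@cLfun2_le f g 1) => //.
by apply: filterS fg => t ->; rewrite mul1r.
Qed.

Lemma cLfun2_conj f : cLfun 2%:E f -> cLfun 2%:E (fun t => (f t)^*%C).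
Proof.
move=> cf; apply: (@cLfun2_le f _ 1) => //.
  by case: cf => mf _; exact: cmeasurable_conj.
by apply: aeW => t; rewrite normc_conj mul1r.
Qed.

Lemma cintegrableM f g : cLfun 2%:E f -> cLfun 2%:E g ->
  cintegrable (fun t => f t * g t).
Proof.
have part (p : R[i] -> R) h : (forall x, `|p x| <= Normc.normc x) ->
    measurable_fun [set: measurableTypeR R] (fun t => p (h t)) ->
    cLfun 2%:E h -> (fun t => p (h t)) \in Lfun mu 2%:E.
  move=> ple mp ch.
  have [mh _] := ch.
  have : cLfun 2%:E (fun t => (p (h t))%:C).
    apply: (@cLfun2_le h _ 1) => //.
    by apply: aeW => t; rewrite normc_real mul1r.
  move=> [_ /Lfun2_integrable_sqr/integrableP[_ lt]].
  rewrite inE; apply/andP; split; rewrite inE//=.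
  rewrite /finite_norm unlock /Lnorm poweR_lty//.
  apply: le_lt_trans lt; rewrite le_eqVlt; apply/orP; left; apply/eqP.
  apply: eq_integral => t _ /=.
  by rewrite powR_mulrn// expr0n addr0 sqrtr_sqr [in RHS]ger0_norm// sqr_ge0.
move=> cf cg; have [[mfr mfi] _] := cf; have [[mgr mgi] _] := cg.
have fr := part _ _ (@ler_normRe R) mfr cf.
have fi := part _ _ (@ler_normIm R) mfi cf.
have gr := part _ _ (@ler_normRe R) mgr cg.
have gi := part _ _ (@ler_normIm R) mgi cg.
have prod (p q : R -> R) : p \in Lfun mu 2%:E -> q \in Lfun mu 2%:E ->
    mu.-integrable setT (fun t => (p t * q t)%:E).
  by move=> pl ql; have /Lfun1_integrable := Lfun2_mul_Lfun1 pl ql.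
split.
  under eq_fun do rewrite ReM EFinB.
  by apply: integrableB => //; exact: prod.
under eq_fun do rewrite ImM EFinD.
by apply: integrableD => //; exact: prod.
Qed.

Lemma cLfun2_cst (c : R[i]) : cLfun 2%:E (fun=> c).
Proof.
apply/cLfun2P; split; first exact: cmeasurable_cst.
rewrite integral_cst//= (@probability_setT _ _ _ mu) mule1.
exact: ltry.
Qed.

Lemma cLfun2_zfunX (n : int) : cLfun 2%:E (fun t => zfun t ^ n : R[i]).
Proof.
apply: (@cLfun2_le (fun=> 1) _ 1); [exact: measurable_zfunX|exact: cLfun2_cst|].
by apply: aeW => t; rewrite normc_zfunX Normc.normc1 mulr1.
Qed.

Lemma cLfunyP f : cLfun +oo%E f <-> cmeasurable f /\
  exists M : R, {ae mu, forall t : measurableTypeR R, Normc.normc (f t) <= M}.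
Proof.
have mu0 : (0 < mu [set: measurableTypeR R])%E by rewrite probability_setT.
split => [[mf]|[mf [M fM]]].
  rewrite inE => /andP[_]; rewrite inE/= /finite_norm unlock /Lnorm mu0 => lt.
  split => //.
  have : ~~ (ess_sup mu (abse \o (EFin \o (fun t => Normc.normc (f t)))) == +oo)%E.
    by rewrite lt_eqF.
  move: (ess_sup_ge mu (abse \o (EFin \o (fun t => Normc.normc (f t))))).
  case: (ess_sup _ _) lt => [M _ h _|//|_ h _].
    exists M; apply: filterS h => t /=; rewrite lee_fin.
    by rewrite ger0_norm// normc_ge0.
  by exists 0; apply: filterS h => t; rewrite leeNy_eq.
split => //; rewrite inE; apply/andP; split; rewrite inE/=.
  exact: cmeasurable_normc.
rewrite /finite_norm unlock /Lnorm mu0.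
apply: (@le_lt_trans _ _ M%:E); last exact: ltry.
apply/ess_supP; apply: filterS fM => t ft /=.
by rewrite lee_fin ger0_norm// normc_ge0.
Qed.

Lemma cLfunM f g : cLfun +oo%E f -> cLfun 2%:E g -> cLfun 2%:E (fun t => f t * g t).
Proof.
move=> /cLfunyP[mf [M fM]] cg; have [mg _] := cg.
apply: (@cLfun2_le g _ M) => //; first exact: cmeasurableM.
apply: filterS fM => t ft.
by rewrite Normc.normcM ler_wpM2r// normc_ge0.
Qed.

End square_integrable.

Section L2_classes.
Context (R : realType).
Local Open Scope complex_scope.
Local Open Scope quotient_scope.
Local Notation mu := (circle_measure R).
Local Coercion L2repr : L2 >-> Funclass.
Implicit Types (x y f g : L2 R).

Lemma L2repr_cLfun x : cLfun 2%:E x.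
Proof. by rewrite /L2repr; case: (repr x) => f /=; rewrite inE. Qed.

(** This lemma and the next ones move between classes and functions: an identity
between classes is an identity almost everywhere between representatives. *)
Lemma pi_L2_ae (f : L2fun R) :
  {ae mu, forall t : measurableTypeR R, L2repr (\pi_(L2 R) f) t = f t}.
Proof.
have : repr (\pi_(L2 R) f) - f \in @null_pred R.
  by rewrite Quotient.idealrBE reprK.
rewrite inE /= => h; apply: filterS h => t ft.
by apply/eqP; rewrite -subr_eq0; apply/eqP; exact: ft.
Qed.

Lemma toL2_ae (f : R -> R[i]) : cLfun 2%:E f ->
  {ae mu, forall t : measurableTypeR R, toL2 f t = f t}.
Proof.
move=> cf; rewrite /toL2; set g := insubd _ f.
have gf : L2fun_val g = f.
  by rewrite -[L2fun_val g]/(val g) /g val_insubd mem_set.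
by apply: filterS (pi_L2_ae g) => t; rewrite gf.
Qed.

Lemma L2_ext x y : {ae mu, forall t : measurableTypeR R, x t = y t} -> x = y.
Proof.
move=> xy; rewrite -[x]reprK -[y]reprK; apply/eqP.
rewrite -Quotient.idealrBE inE /=.
apply: filterS xy => t; rewrite /L2repr => e.
by rewrite -[LHS]/(repr x t - repr y t) e subrr.
Qed.

Lemma L2D_ae x y :
  {ae mu, forall t : measurableTypeR R, L2repr (x + y) t = x t + y t}.
Proof.
have -> : x + y = \pi_(L2 R) (repr x + repr y) by rewrite pi_L2D !reprK.
exact: pi_L2_ae.
Qed.

Lemma L2Z_ae (a : R[i]) x :
  {ae mu, forall t : measurableTypeR R, L2repr (a *: x) t = a * x t}.
Proof. exact: (pi_L2_ae (a *: repr x)). Qed.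

Lemma conjL2_ae x :
  {ae mu, forall t : measurableTypeR R, conjL2 x t = (x t)^*%C}.
Proof. by apply: toL2_ae; apply: cLfun2_conj; exact: L2repr_cLfun. Qed.

Lemma mulL2_ae f x : Linfty f ->
  {ae mu, forall t : measurableTypeR R, (f ** x) t = f t * x t}.
Proof. by move=> ?; apply: toL2_ae; apply: cLfunM => //; exact: L2repr_cLfun. Qed.

Definition zn (n : int) : L2 R := toL2 (fun t => zfun t ^ n).

Lemma zn_ae n :
  {ae mu, forall t : measurableTypeR R, zn n t = zfun t ^ n}.
Proof. by apply: toL2_ae; exact: cLfun2_zfunX. Qed.

Lemma LinftyP f : Linfty f <->
  exists M : R, {ae mu, forall t : measurableTypeR R, Normc.normc (f t) <= M}.
Proof.
split; first by move=> /cLfunyP[].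
by move=> fM; apply/cLfunyP; split => //; case: (L2repr_cLfun f).
Qed.

Lemma Linfty_zn n : Linfty (zn n).
Proof.
by apply/LinftyP; exists 1; apply: filterS (zn_ae n) => t ->; rewrite normc_zfunX.
Qed.

Lemma LinftyD f g : Linfty f -> Linfty g -> Linfty (f + g).
Proof.
move=> /LinftyP[M fM] /LinftyP[N gN]; apply/LinftyP; exists (M + N).
apply: filterS3 fM gN (L2D_ae f g) => t ft gt ->.
by rewrite (le_trans (le_normcD _ _))// lerD.
Qed.

Lemma LinftyZ (a : R[i]) f : Linfty f -> Linfty (a *: f).
Proof.
move=> /LinftyP[M fM]; apply/LinftyP; exists (Normc.normc a * M).
apply: filterS2 fM (L2Z_ae a f) => t ft ->.
by rewrite Normc.normcM ler_wpM2l// normc_ge0.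
Qed.

Lemma LinftyB f g : Linfty f -> Linfty g -> Linfty (f - g).
Proof. by move=> ? ?; rewrite -scaleN1r; apply: LinftyD => //; exact: LinftyZ. Qed.

Lemma Linfty_conj f : Linfty f -> Linfty (conjL2 f).
Proof.
move=> /LinftyP[M fM]; apply/LinftyP; exists M.
by apply: filterS2 fM (conjL2_ae f) => t ft ->; rewrite normc_conj.
Qed.

Lemma LinftyM f g : Linfty f -> Linfty g -> Linfty (f ** g).
Proof.
move=> /[dup] lf /LinftyP[M fM] /LinftyP[N gN]; apply/LinftyP; exists (M * N).
apply: filterS3 fM gN (mulL2_ae g lf) => t ft gt ->.
by rewrite Normc.normcM ler_pM// normc_ge0.
Qed.

End L2_classes.

(** * The inner product and the projection theorem *)

Section inner_product.
Context (R : realType).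
Local Open Scope complex_scope.
Local Notation mu := (circle_measure R).
Local Coercion L2repr : L2 >-> Funclass.
Implicit Types (x y u v m : L2 R) (a : R[i]).

Lemma inner_integrable x y : cintegrable (fun t => x t * (y t)^*%C).
Proof.
by apply: cintegrableM; [exact: L2repr_cLfun|apply: cLfun2_conj; exact: L2repr_cLfun].
Qed.

Lemma inner_ae x y (f g : R -> R[i]) : cmeasurable f -> cmeasurable g ->
  {ae mu, forall t : measurableTypeR R, x t = f t} ->
  {ae mu, forall t : measurableTypeR R, y t = g t} ->
  inner x y = cintegral (fun t => f t * (g t)^*%C).
Proof.
move=> mf mg xf yg; apply: cintegral_ae_eq.
- exact/cintegrable_measurable/inner_integrable.
- by apply: cmeasurableM => //; exact: cmeasurable_conj.
- by apply: filterS2 xf yg => t -> ->.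
Qed.

Lemma innerC x y : inner y x = (inner x y)^*%C.
Proof.
rewrite -cintegral_conj; last exact: inner_integrable.
by apply: eq_cintegral => t; rewrite conjcM conjcK mulrC.
Qed.

Lemma innerDl x y v : inner (x + y) v = inner x v + inner y v.
Proof.
rewrite /inner -cintegralD; [|exact: inner_integrable..].
apply: cintegral_ae_eq.
- exact/cintegrable_measurable/inner_integrable.
- by apply: cintegrable_measurable; apply: cintegrableD; exact: inner_integrable.
- by apply: filterS (L2D_ae x y) => t ->; rewrite mulrDl.
Qed.

Lemma innerZl a x v : inner (a *: x) v = a * inner x v.
Proof.
rewrite /inner -cintegralZ; last exact: inner_integrable.
apply: cintegral_ae_eq.
- exact/cintegrable_measurable/inner_integrable.
- by apply: cintegrable_measurable; apply: cintegrableZ; exact: inner_integrable.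
- by apply: filterS (L2Z_ae a x) => t ->; rewrite mulrA.
Qed.

Lemma innerBl x y v : inner (x - y) v = inner x v - inner y v.
Proof. by rewrite -scaleN1r innerDl innerZl mulN1r. Qed.

Lemma innerDr x y v : inner v (x + y) = inner v x + inner v y.
Proof. by rewrite innerC innerDl conjcD -!innerC. Qed.

Lemma innerZr a x v : inner v (a *: x) = a^*%C * inner v x.
Proof. by rewrite innerC innerZl conjcM -innerC. Qed.

Lemma innerBr x y v : inner v (x - y) = inner v x - inner v y.
Proof. by rewrite innerC innerBl conjcB -!innerC. Qed.

Lemma inner0l v : inner 0 v = 0.
Proof. by rewrite -[0](scale0r (0 : L2 R)) innerZl mul0r. Qed.

Definition sqnorm x : R := complex.Re (inner x x).

Lemma sqnormE x : (\int[mu]_t (Normc.normc (x t) ^+ 2)%:E)%E = (sqnorm x)%:E.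
Proof.
have [ir _] := inner_integrable x x.
have eR : (fun t => (complex.Re (x t * (x t)^*%C))%:E) =
          (fun t => (Normc.normc (x t) ^+ 2)%:E).
  apply/funext => t; rewrite ReM ReC ImC normc_sqr.
  by rewrite mulrN opprK !expr2.
rewrite /sqnorm /inner /cintegral /= /Rintegral -eR fineK//.
exact: integrable_fin_num.
Qed.

Lemma sqnorm_ge0 x : 0 <= sqnorm x.
Proof. by rewrite -lee_fin -sqnormE; apply: integral_ge0 => t _; rewrite lee_fin sqr_ge0. Qed.

Lemma inner_sqnorm x : inner x x = (sqnorm x)%:C.
Proof.
apply: complex_ext => //=.
have /(congr1 (@complex.Im R)) := innerC x x; rewrite ImC.
by move/eqP; rewrite -addr_eq0 -mulr2n mulrn_eq0 => /eqP.
Qed.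

Lemma sqnorm_eq0 x : sqnorm x = 0 -> x = 0.
Proof.
move=> x0; have := sqnormE x; rewrite x0 => int0.
apply: L2_ext; have [mx _] := L2repr_cLfun x.
have : ae_eq mu setT (fun t => (Normc.normc (x t) ^+ 2)%:E) (cst 0%E).
  apply/ae_eq_integral_abs => //.
    apply/measurable_EFinP; apply: measurable_funX; exact: cmeasurable_normc.
  by rewrite -[RHS]int0; apply: eq_integral => t _; rewrite gee0_abs// lee_fin sqr_ge0.
have h0 : {ae mu, forall t : measurableTypeR R, L2repr (0 : L2 R) t = 0}.
  by apply: filterS (L2Z_ae 0 0) => t; rewrite scale0r mul0r.
move=> h; apply: filterS2 h h0 => t /(_ I) xt' ->.
have /eqP xt := EFin_inj xt'.
by move: xt; rewrite sqrf_eq0 => /eqP xt; exact: Normc.eq0_normc.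
Qed.

Lemma sqnormB u v :
  (sqnorm (u - v))%:C = (sqnorm u)%:C - inner u v - (inner u v)^*%C + (sqnorm v)%:C.
Proof.
by rewrite -!inner_sqnorm -innerC innerBl !innerBr opprB addrA addrAC.
Qed.

(** By Pythagoras' theorem the squared distance from [u] to the line spanned by [m]
is [sqnorm u - |<u, m>|^2 / sqnorm m]. With [d = 0] this is the Cauchy-Schwarz
inequality; with [d] close to [sqnorm u] it says that [u] is almost orthogonal
to [m]. *)
Lemma inner_dist u m (d : R) : (forall a, d <= sqnorm (u - a *: m)) ->
  Normc.normc (inner u m) ^+ 2 <= (sqnorm u - d) * sqnorm m.
Proof.
move=> dle; have := sqnorm_ge0 m; rewrite le_eqVlt => /orP[/eqP m0|m0].
  have -> : m = 0 by exact/sqnorm_eq0.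
  have -> : sqnorm 0 = 0 by rewrite /sqnorm inner0l.
  by rewrite innerC inner0l conjc0 Normc.normc0 expr0n mulr0.
set c := inner u m.
have := dle (c / (sqnorm m)%:C).
have -> : sqnorm (u - (c / (sqnorm m)%:C) *: m) =
          sqnorm u - Normc.normc c ^+ 2 / sqnorm m.
  apply: (@complexI R).
  rewrite sqnormB innerZr -/c -[(sqnorm (_ *: m))%:C]inner_sqnorm.
  rewrite innerZl innerZr inner_sqnorm.
  have mC : (sqnorm m)%:C != 0 :> R[i] by rewrite eq_complex /= eqxx andbT gt_eqF.
  have -> : (c / (sqnorm m)%:C)^*%C = c^*%C / (sqnorm m)%:C.
    by rewrite conjcM conjc_inv conjc_real.
  have -> : (sqnorm u - Normc.normc c ^+ 2 / sqnorm m)%:C =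
      (sqnorm u)%:C - c * c^*%C / (sqnorm m)%:C.
    by rewrite mulc_conj rmorphB rmorphM fmorphV.
  rewrite !conjcM conjc_inv conjc_real conjcK.
  by field.
rewrite lerBrDr -lerBrDl => h.
by rewrite -ler_pdivrMr.
Qed.

Lemma cauchy_schwarz u m : Normc.normc (inner u m) ^+ 2 <= sqnorm u * sqnorm m.
Proof. by rewrite -[sqnorm u]subr0; apply: inner_dist => a; exact: sqnorm_ge0. Qed.

Lemma parallelogram u v :
  sqnorm (u + v) + sqnorm (u - v) = (sqnorm u + sqnorm v) *+ 2.
Proof.
rewrite /sqnorm innerBl !innerBr innerDl !innerDr -!ReD mulr2n -ReD.
by congr complex.Re; ring.
Qed.

Lemma sqnormZ a u : sqnorm (a *: u) = Normc.normc a ^+ 2 * sqnorm u.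
Proof.
rewrite /sqnorm innerZl innerZr inner_sqnorm normc_sqr.
by rewrite !ReM !ImM ReC ImC /=; ring.
Qed.

End inner_product.

Section hilbert_space.
Context (R : realType).
Local Open Scope complex_scope.
Local Notation mu := (circle_measure R).
Local Coercion L2repr : L2 >-> Funclass.
Implicit Types (x y u v m : L2 R) (a : R[i]).

Lemma L2B_ae x y :
  {ae mu, forall t : measurableTypeR R, L2repr (x - y) t = x t - y t}.
Proof.
rewrite -scaleN1r; apply: filterS2 (L2D_ae x (-1 *: y)) (L2Z_ae (-1) y) => t -> ->.
by rewrite mulN1r.
Qed.

Lemma le0_of_geometric (r C : R) :
  (forall k, r <= C * (2^-1 ^+ k) ^+ 2) -> r <= 0.
Proof.
move=> rC; have cvg0 : (fun k => C * (2^-1 ^+ k) ^+ 2) @ \oo --> (0 : R).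
  rewrite -(mulr0 C); apply: cvgM; first exact: cvg_cst.
  under eq_fun do rewrite exprAC.
  by apply: cvg_expr; rewrite ger0_norm ?sqr_ge0// expr_lt1// invf_lt1// ltr1n.
by apply: (cvgr_to_ge cvg0); exact: nearW.
Qed.

Lemma normc_eq0_of_geometric (c : R[i]) (C : R) :
  (forall k, Normc.normc c ^+ 2 <= C * (2^-1 ^+ k) ^+ 2) -> c = 0.
Proof.
move=> /le0_of_geometric c0; apply: Normc.eq0_normc; apply/eqP.
by rewrite -sqrf_eq0 eq_le c0 sqr_ge0.
Qed.

(** The real and imaginary parts converge separately, which accounts for the factor
[2]. *)
Lemma L2_complete (s : nat -> L2 R) :
  (forall k j, (k <= j)%N -> sqnorm (s j - s k) <= (2^-1 ^+ k) ^+ 2) ->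
  exists x, forall k, sqnorm (x - s k) <= 2 * (2^-1 ^+ k) ^+ 2.
Proof.
move=> cauchy.
have mRe k : measurable_fun [set: measurableTypeR R] (fun t => complex.Re (s k t)).
  by case: (L2repr_cLfun (s k)) => -[].
have mIm k : measurable_fun [set: measurableTypeR R] (fun t => complex.Im (s k t)).
  by case: (L2repr_cLfun (s k)) => -[].
have mn (w : L2 R) : measurable_fun [set: measurableTypeR R]
    (fun t => (Normc.normc (w t) ^+ 2)%:E).
  apply/measurable_EFinP; apply: measurable_funX; apply: cmeasurable_normc.
  by case: (L2repr_cLfun w).
have cRe k j : (k <= j)%N -> (\int[mu]_t
    ((complex.Re (s j t) - complex.Re (s k t)) ^+ 2)%:E <= ((2^-1 ^+ k) ^+ 2)%:E)%E.
  move=> kj; apply: (@le_trans _ _ (sqnorm (s j - s k))%:E); last first.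
    by rewrite lee_fin cauchy.
  rewrite -sqnormE; apply: ae_ge0_le_integral => //.
  - by move=> t _; rewrite lee_fin sqr_ge0.
  - by apply/measurable_EFinP; apply: measurable_funX; exact: measurable_funB.
  - by move=> t _; rewrite lee_fin sqr_ge0.
  - apply: filterS (L2B_ae (s j) (s k)) => t -> _.
    by rewrite lee_fin normc_sqr ReB ImB lerDl sqr_ge0.
have cIm k j : (k <= j)%N -> (\int[mu]_t
    ((complex.Im (s j t) - complex.Im (s k t)) ^+ 2)%:E <= ((2^-1 ^+ k) ^+ 2)%:E)%E.
  move=> kj; apply: (@le_trans _ _ (sqnorm (s j - s k))%:E); last first.
    by rewrite lee_fin cauchy.
  rewrite -sqnormE; apply: ae_ge0_le_integral => //.
  - by move=> t _; rewrite lee_fin sqr_ge0.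
  - by apply/measurable_EFinP; apply: measurable_funX; exact: measurable_funB.
  - by move=> t _; rewrite lee_fin sqr_ge0.
  - apply: filterS (L2B_ae (s j) (s k)) => t -> _.
    by rewrite lee_fin normc_sqr ReB ImB lerDr sqr_ge0.
have [fr mfr frE] := riesz_fischer mRe cRe.
have [fi mfi fiE] := riesz_fischer mIm cIm.
pose G k (t : R) := (fr t +i* fi t) - s k t.
have mG k : cmeasurable (G k).
  split; [under eq_fun do rewrite ReB|under eq_fun do rewrite ImB];
  exact: measurable_funB.
have GE k : (\int[mu]_t (Normc.normc (G k t) ^+ 2)%:E <=
             (2 * (2^-1 ^+ k) ^+ 2)%:E)%E.
  rewrite (_ : (fun t => _) = (fun t => (((fr t - complex.Re (s k t)) ^+ 2)%:E +
    ((fi t - complex.Im (s k t)) ^+ 2)%:E)%E)); last first.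
    by apply/funext => t; rewrite normc_sqr ReB ImB.
  rewrite ge0_integralD//; last 4 first.
  - by move=> t _; rewrite lee_fin sqr_ge0.
  - by apply/measurable_EFinP; apply: measurable_funX; exact: measurable_funB.
  - by move=> t _; rewrite lee_fin sqr_ge0.
  - by apply/measurable_EFinP; apply: measurable_funX; exact: measurable_funB.
  by rewrite mulr_natl mulr2n EFinD leeD.
have cG k : cLfun 2%:E (G k).
  by apply/cLfun2P; split => //; apply: le_lt_trans (GE k) _; exact: ltry.
exists (toL2 (G 0%N) + s 0%N) => k.
rewrite -lee_fin; apply: le_trans (GE k); rewrite -sqnormE.
rewrite le_eqVlt; apply/orP; left; apply/eqP; apply: ge0_ae_eq_integral => //.
- apply/measurable_EFinP; apply: measurable_funX; exact: cmeasurable_normc.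
- by move=> t _; rewrite lee_fin sqr_ge0.
- by move=> t _; rewrite lee_fin sqr_ge0.
- apply: filterS3 (L2B_ae (toL2 (G 0%N) + s 0%N) (s k))
    (L2D_ae (toL2 (G 0%N)) (s 0%N)) (toL2_ae (cG 0%N)) => t -> -> -> _.
  by rewrite /G subrK.
Qed.

(** The projection theorem for the orthogonal complement [M] of [W]. A sequence in
[M] minimizing the distance to [x] is Cauchy by the parallelogram identity, its
limit [y] stays orthogonal to [W], and [inner_dist] makes [x - y] orthogonal to
[M]. *)
Lemma orthogonal_decomposition (W : set (L2 R)) x :
  exists y, (forall w, W w -> inner y w = 0) /\
    (forall m, (forall w, W w -> inner m w = 0) -> inner (x - y) m = 0).
Proof.
pose M m := forall w, W w -> inner m w = 0.
have MD m1 m2 : M m1 -> M m2 -> M (m1 + m2).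
  by move=> h1 h2 w Ww; rewrite innerDl h1// h2// addr0.
have MZ a m : M m -> M (a *: m) by move=> h w Ww; rewrite innerZl h// mulr0.
have M0 : M 0 by move=> w _; rewrite inner0l.
pose D := [set sqnorm (x - m) | m in M].
have hD : has_inf D.
  split; first by exists (sqnorm (x - 0)); exists 0.
  by exists 0 => _ [m _ <-]; exact: sqnorm_ge0.
pose e k : R := 2^-1 ^+ k.
have e0 k : 0 < e k by rewrite exprn_gt0// invr_gt0.
have ele k j : (k <= j)%N -> e j <= e k.
  by move=> kj; rewrite ler_wiXn2l// ?invr_ge0// invf_le1// ler1n.
have dle m : M m -> inf D <= sqnorm (x - m).
  by move=> Mm; apply: inf_lbound; [exact: hD.2|exists m].
(* The error [e k ^+ 2 / 4] makes the parallelogram identity give [e k ^+ 2]. *)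
have /choice[s sP] : forall k, exists m, M m /\ sqnorm (x - m) <= inf D + e k ^+ 2 / 4.
  move=> k; have e4 : 0 < e k ^+ 2 / 4 by rewrite divr_gt0// exprn_gt0.
  have [_ [m Mm <-] lt] := inf_adherent e4 hD.
  by exists m; split => //; exact: ltW.
have cs k j : (k <= j)%N -> sqnorm (s j - s k) <= e k ^+ 2.
  move=> kj; have [Mj lej] := sP j; have [Mk lek] := sP k.
  have := parallelogram (x - s k) (x - s j).
  have -> : x - s k - (x - s j) = s j - s k by rewrite opprB addrC addrA subrK.
  have -> : x - s k + (x - s j) = 2%:R *: (x - 2%:R^-1 *: (s k + s j)).
    rewrite scalerBr scalerA divff ?pnatr_eq0// scale1r scaler_nat mulr2n opprD.
    by rewrite addrACA.
  rewrite sqnormZ.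
  have -> : Normc.normc (2%:R : R[i]) = 2.
    by rewrite -(rmorph_nat (@real_complex_def R (Phant R))) normc_real ger0_norm.
  have := dle _ (MZ 2%:R^-1 _ (MD _ _ Mk Mj)).
  have : e j ^+ 2 <= e k ^+ 2 by rewrite lerXn2r ?nnegrE ?(ltW (e0 _))// ele.
  by lra.
have [y yP] := L2_complete cs.
exists y; split => [w Ww|m Mm].
  apply: (@normc_eq0_of_geometric _ (2 * sqnorm w)) => k.
  have -> : inner y w = inner (y - s k) w.
    by rewrite innerBl (sP k).1// subr0.
  apply: (le_trans (cauchy_schwarz _ _)).
  by rewrite mulrAC ler_wpM2r// sqnorm_ge0.
apply: (@normc_eq0_of_geometric _ (5 * sqnorm m)) => k.
have -> : inner (x - y) m = inner (x - s k) m - inner (y - s k) m.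
  by rewrite -innerBl opprB addrA subrK.
have A : Normc.normc (inner (x - s k) m) ^+ 2 <= e k ^+ 2 / 4 * sqnorm m.
  apply: (le_trans (inner_dist (d := inf D) _)) => [a|].
    rewrite -addrA -opprD; apply: dle; apply: MD; last exact: MZ.
    exact: (sP k).1.
  by rewrite ler_wpM2r ?sqnorm_ge0// lerBlDl; exact: (sP k).2.
have B : Normc.normc (inner (y - s k) m) ^+ 2 <= 2 * e k ^+ 2 * sqnorm m.
  by apply: (le_trans (cauchy_schwarz _ _)); rewrite ler_wpM2r ?sqnorm_ge0.
move: A B; set a := inner _ m; set b := inner _ m => A B.
have n2 : Normc.normc (a - b) ^+ 2 <=
    2 * (Normc.normc a ^+ 2 + Normc.normc b ^+ 2).
  apply: (@le_trans _ _ ((Normc.normc a + Normc.normc b) ^+ 2)).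
    rewrite lerXn2r ?nnegrE ?addr_ge0 ?normc_ge0//.
    by rewrite -(normcN b) le_normcD.
  rewrite -subr_ge0 (_ : _ - _ = (Normc.normc a - Normc.normc b) ^+ 2).
    exact: sqr_ge0.
  by ring.
apply: (le_trans n2); apply: (@le_trans _ _ (2 * (e k ^+ 2 / 4 * sqnorm m +
  2 * e k ^+ 2 * sqnorm m))); first by rewrite ler_pM2l// lerD.
have := mulr_ge0 (sqr_ge0 (e k)) (sqnorm_ge0 m); rewrite -/(e k).
by move: (e k ^+ 2) (sqnorm m) => E N EN; lra.
Qed.

End hilbert_space.

(** * Fourier coefficients *)

Section fourier_of_powers.
Context (R : realType).
Local Open Scope complex_scope.
Local Notation mu := (circle_measure R).

Lemma zfunX_cos_sin (t : R) (k : nat) :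
  zfun t ^+ k = cos (k%:R * t) +i* sin (k%:R * t).
Proof.
elim: k => [|k IH]; first by rewrite expr0 mul0r cos0 sin0.
rewrite exprS IH -natr1 mulrDl mul1r cosD sinD.
by apply: complex_ext; rewrite ?ReM ?ImM /=; ring.
Qed.

(* The additive constant makes the function nonnegative, as the formula for the
   integral against a uniform law asks. *)
Let int_deriv (f F : R -> R) (F2 : F (pi *+ 2) = F 0) :
  continuous f -> (forall t, `|f t| <= 1) ->
  (forall t : R, is_derive t 1 F (f t)) ->
  Rintegral mu setT f = 0.
Proof.
move=> cf f1 dF.
have mf : measurable_fun [set: measurableTypeR R] f.
  exact: continuous_measurable_fun.
have intf : mu.-integrable setT (fun t : measurableTypeR R => (f t)%:E).
  apply: (@le_integrable _ _ _ _ _ _ _ (fun=> 1%:E)) => //.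
  - exact/measurable_EFinP.
  - by move=> t _; rewrite /= lee_fin normr1.
  - exact: finite_measure_integrable_cst.
have p2 := twopi_gt0 R.
have int1 : (\int[mu]_t (1 + f t)%:E = 1)%E.
  rewrite /circle_measure integral_uniform//; last 2 first.
  - by apply/measurable_EFinP; exact: measurable_funD.
  - move=> t; rewrite lee_fin -lerBlDl sub0r.
    by have := f1 t; rewrite ler_norml => /andP[].
  pose G t := t + F t.
  have dG (t : R) : is_derive t 1 G (1 + f t).
    exact: (is_deriveD (is_derive_id t 1) (dF t)).
  rewrite (@continuous_FTC2 _ (fun t => 1 + f t) G)//.
  - rewrite /G F2 -EFinB -EFinM (_ : _ - (0 + F 0) = pi *+ 2); last by ring.
    by rewrite subr0 mulVf// gt_eqF.
  - apply: continuous_subspaceT => t; apply: cvgD; [exact: cvg_cst|exact: cf].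
  - split.
    + by move=> t _; have [] := dG t.
    + apply: cvg_at_right_filter; apply: differentiable_continuous.
      by apply/derivable1_diffP; have [] := dG 0.
    + apply: cvg_at_left_filter; apply: differentiable_continuous.
      by apply/derivable1_diffP; have [] := dG (pi *+ 2).
  - by move=> t _; rewrite derive1E; have [_ ->] := dG t.
have fin := integrable_fin_num measurableT intf.
have : (1 + \int[mu]_t (f t)%:E = 1 :> \bar R)%E.
  rewrite -[RHS]int1.
  under [RHS]eq_integral do rewrite EFinD.
  rewrite integralD//; last exact: finite_measure_integrable_cst.
  by rewrite [X in _ = (X + _)%E]integral_cst//= (@probability_setT _ _ _ mu) mule1.
rewrite -(fineK fin) -EFinD => /eqP; rewrite eqe -subr_eq0 addrAC subrr add0r.
by move/eqP.
Qed.

Let scale_2pi (k : nat) : k%:R * (pi *+ 2) = 0 + (pi *+ 2) *+ k :> R.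
Proof. by rewrite add0r mulr_natl. Qed.

Let derive_scale (c t : R) : is_derive t 1 (fun t => c * t) c.
Proof.
rewrite -[X in is_derive _ _ _ X]mulr1.
exact: (is_deriveZ c (is_derive_id t 1)).
Qed.

Let int_cos (k : nat) : (0 < k)%N ->
  Rintegral mu setT (fun t : R => cos (k%:R * t)) = 0.
Proof.
move=> k0; have kn0 : k%:R != 0 :> R by rewrite pnatr_eq0 -lt0n.
apply: (@int_deriv _ (fun t => k%:R^-1 * sin (k%:R * t))).
- by rewrite scale_2pi (periodicn (@sinD2pi R)) mulr0.
- by move=> t; apply: continuous_comp; [exact: mulrl_continuous|exact: continuous_cos].
- by move=> t; rewrite ler_norml cos_geN1 cos_le1.
- move=> t; have := is_deriveZ k%:R^-1
    (is_derive1_comp (is_derive_sin (k%:R * t)) (derive_scale k%:R t)).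
  by rewrite /GRing.scale /= mulrCA mulVf// mulr1.
Qed.

Let int_sin (k : nat) : (0 < k)%N ->
  Rintegral mu setT (fun t : R => sin (k%:R * t)) = 0.
Proof.
move=> k0; have kn0 : k%:R != 0 :> R by rewrite pnatr_eq0 -lt0n.
apply: (@int_deriv _ (fun t => - k%:R^-1 * cos (k%:R * t))).
- by rewrite scale_2pi (periodicn (@cosD2pi R)) mulr0.
- by move=> t; apply: continuous_comp; [exact: mulrl_continuous|exact: continuous_sin].
- by move=> t; rewrite ler_norml sin_geN1 sin_le1.
- move=> t; have := is_deriveZ (- k%:R^-1)
    (is_derive1_comp (is_derive_cos (k%:R * t)) (derive_scale k%:R t)).
  by rewrite /GRing.scale /= !mulNr mulrN opprK mulrCA mulVf// mulr1.
Qed.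

Lemma cintegral_zfunX (n : int) : cintegral (fun t : R => zfun t ^ n) = (n == 0)%:R.
Proof.
have pos (k : nat) : (0 < k)%N -> cintegral (fun t : R => zfun t ^+ k) = 0.
  move=> k0; under eq_fun do rewrite zfunX_cos_sin.
  by rewrite /cintegral /= int_cos// int_sin.
case: n => [[|k]|k].
- rewrite eqxx /cintegral /= /Rintegral !integral_cst//= (@probability_setT _ _ _ mu).
  by rewrite mule1 mul0e.
- exact: pos.
- have intz : cintegrable (fun t : R => zfun t ^+ k.+1).
    have := @cintegrableM _ _ _ (@cLfun2_zfunX R k.+1) (@cLfun2_cst R 1).
    by under eq_fun do rewrite mulr1.
  transitivity (cintegral (fun t : R => (zfun t ^+ k.+1)^*%C)).
    apply: eq_cintegral => t.
    by rewrite -[zfun t ^+ _]/(zfun t ^ k.+1) zfunX_conj NegzE.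
  by rewrite cintegral_conj// pos// conjc0.
Qed.

End fourier_of_powers.

Section fourier_coefs.
Context (R : realType).
Local Open Scope complex_scope.
Local Notation mu := (circle_measure R).
Local Notation coef := (@fourier_coef R).
Local Coercion L2repr : L2 >-> Funclass.
Implicit Types (x y w f g h : L2 R) (a : R[i]) (n m : int).

Lemma coefE x n : coef x n = inner x (zn R n).
Proof.
apply/esym; apply: inner_ae; [|exact: measurable_zfunX|exact: aeW|exact: zn_ae].
by have [] := L2repr_cLfun x.
Qed.

Lemma coefD x y n : coef (x + y) n = coef x n + coef y n.
Proof. by rewrite !coefE innerDl. Qed.

Lemma coefZ a x n : coef (a *: x) n = a * coef x n.
Proof. by rewrite !coefE innerZl. Qed.

Lemma coefB x y n : coef (x - y) n = coef x n - coef y n.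
Proof. by rewrite !coefE innerBl. Qed.

Lemma coef0 n : coef 0 n = 0.
Proof. by rewrite coefE inner0l. Qed.

Lemma coef_zn m n : coef (zn R m) n = (m == n)%:R.
Proof.
rewrite coefE (inner_ae (measurable_zfunX R m) (measurable_zfunX R n) (zn_ae R m) (zn_ae R n)).
under eq_cintegral do rewrite zfunX_conj -zfunD.
by rewrite cintegral_zfunX subr_eq0.
Qed.

(** Injectivity of the Fourier transform. Below, identities between classes are
proved by comparing coefficients. *)
Lemma coef_ext x y : (forall n, coef x n = coef y n) -> x = y.
Proof.
move=> xy; apply/eqP; rewrite -subr_eq0; apply/eqP; apply: L2_ext.
have c0 n : coef (x - y) n = 0 by rewrite coefB xy subrr.
have h0 : {ae mu, forall t : measurableTypeR R, L2repr (0 : L2 R) t = 0}.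
  by apply: filterS (L2Z_ae 0 0) => t; rewrite scale0r mul0r.
have int : cintegrable (L2repr (x - y)).
  have := cintegrableM (L2repr_cLfun (x - y)) (@cLfun2_cst R 1).
  by under eq_fun do rewrite mulr1.
apply: filterS2 (zfun_total int _) h0 => [t -> -> //|n].
by rewrite -[RHS](c0 (- n)); apply: eq_cintegral => t; rewrite zfunX_conj opprK.
Qed.

Lemma mulL2Dr f x y : Linfty f -> f ** (x + y) = f ** x + f ** y.
Proof.
move=> lf; apply: L2_ext.
apply: filterS3 (filterI (L2D_ae (f ** x) (f ** y)) (mulL2_ae (x + y) lf))
  (L2D_ae x y) (filterI (mulL2_ae x lf) (mulL2_ae y lf)) => t [-> ->] -> [-> ->].
by rewrite mulrDr.
Qed.

Lemma mulL2Zr f a x : Linfty f -> f ** (a *: x) = a *: (f ** x).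
Proof.
move=> lf; apply: L2_ext.
apply: filterS2 (filterI (L2Z_ae a (f ** x)) (mulL2_ae (a *: x) lf))
  (filterI (L2Z_ae a x) (mulL2_ae x lf)) => t [-> ->] [-> ->].
by rewrite mulrCA.
Qed.

Lemma mulL2Br f x y : Linfty f -> f ** (x - y) = f ** x - f ** y.
Proof. by move=> lf; rewrite -(scaleN1r y) mulL2Dr// mulL2Zr// scaleN1r. Qed.

Lemma mulL2Dl f g x : Linfty f -> Linfty g -> (f + g) ** x = f ** x + g ** x.
Proof.
move=> lf lg; apply: L2_ext.
apply: filterS3 (filterI (L2D_ae (f ** x) (g ** x)) (mulL2_ae x (LinftyD lf lg)))
  (L2D_ae f g) (filterI (mulL2_ae x lf) (mulL2_ae x lg)) => t [-> ->] -> [-> ->].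
by rewrite mulrDl.
Qed.

Lemma mulL2Zl a f x : Linfty f -> (a *: f) ** x = a *: (f ** x).
Proof.
move=> lf; apply: L2_ext.
apply: filterS2 (filterI (L2Z_ae a (f ** x)) (mulL2_ae x (LinftyZ a lf)))
  (filterI (L2Z_ae a f) (mulL2_ae x lf)) => t [-> ->] [-> ->].
by rewrite mulrA.
Qed.

Lemma mulL2Bl f g x : Linfty f -> Linfty g -> (f - g) ** x = f ** x - g ** x.
Proof.
move=> lf lg; rewrite -(scaleN1r g) mulL2Dl ?mulL2Zl ?scaleN1r//.
by rewrite -scaleN1r; exact: LinftyZ.
Qed.

Lemma mulL2A f g x : Linfty f -> Linfty g -> f ** (g ** x) = (f ** g) ** x.
Proof.
move=> lf lg; apply: L2_ext.
apply: filterS2 (filterI (mulL2_ae (g ** x) lf) (mulL2_ae x lg))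
  (filterI (mulL2_ae x (LinftyM lf lg)) (mulL2_ae g lf)) => t [-> ->] [-> ->].
by rewrite mulrA.
Qed.

Lemma mulL2C f g : Linfty f -> Linfty g -> f ** g = g ** f.
Proof.
move=> lf lg; apply: L2_ext.
by apply: filterS2 (mulL2_ae g lf) (mulL2_ae f lg) => t -> ->; rewrite mulrC.
Qed.

Lemma mulL2CA f g x : Linfty f -> Linfty g -> f ** (g ** x) = g ** (f ** x).
Proof. by move=> lf lg; rewrite !mulL2A// (mulL2C lf). Qed.

Lemma conjL2K : involutive (@conjL2 R).
Proof.
move=> x; apply: L2_ext.
by apply: filterS2 (conjL2_ae (conjL2 x)) (conjL2_ae x) => t -> ->; rewrite conjcK.
Qed.

Lemma conjL2D x y : conjL2 (x + y) = conjL2 x + conjL2 y.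
Proof.
apply: L2_ext.
apply: filterS3 (filterI (conjL2_ae (x + y)) (L2D_ae (conjL2 x) (conjL2 y)))
  (L2D_ae x y) (filterI (conjL2_ae x) (conjL2_ae y)) => t [-> ->] -> [-> ->].
exact: conjcD.
Qed.

Lemma conjL2Z a x : conjL2 (a *: x) = a^*%C *: conjL2 x.
Proof.
apply: L2_ext.
apply: filterS2 (filterI (conjL2_ae (a *: x)) (L2Z_ae a^*%C (conjL2 x)))
  (filterI (L2Z_ae a x) (conjL2_ae x)) => t [-> ->] [-> ->].
exact: conjcM.
Qed.

Lemma conjL2B x y : conjL2 (x - y) = conjL2 x - conjL2 y.
Proof. by rewrite -(scaleN1r y) conjL2D conjL2Z rmorphN1 scaleN1r. Qed.

Lemma conjL2M f x : Linfty f -> conjL2 (f ** x) = conjL2 f ** conjL2 x.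
Proof.
move=> lf; apply: L2_ext.
apply: filterS3 (filterI (conjL2_ae (f ** x)) (mulL2_ae (conjL2 x) (Linfty_conj lf)))
  (mulL2_ae x lf) (filterI (conjL2_ae f) (conjL2_ae x)) => t [-> ->] -> [-> ->].
exact: conjcM.
Qed.

Lemma conj_zn n : conjL2 (zn R n) = zn R (- n).
Proof.
apply: L2_ext; apply: filterS3 (conjL2_ae (zn R n)) (zn_ae R n) (zn_ae R (- n)).
by move=> t -> -> ->; rewrite zfunX_conj.
Qed.

Lemma mul_zn n m : zn R n ** zn R m = zn R (n + m).
Proof.
apply: L2_ext; apply: filterS3 (mulL2_ae (zn R m) (Linfty_zn R n))
  (filterI (zn_ae R n) (zn_ae R m)) (zn_ae R (n + m)).
by move=> t -> [-> ->] ->; rewrite zfunD.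
Qed.

Lemma mul_zn0 x : zn R 0 ** x = x.
Proof.
apply: L2_ext; apply: filterS2 (mulL2_ae x (Linfty_zn R 0)) (zn_ae R 0).
by move=> t -> ->; rewrite expr0z mul1r.
Qed.

Lemma mul_znA n m x : zn R n ** (zn R m ** x) = zn R (n + m) ** x.
Proof. by rewrite mulL2A ?mul_zn//; exact: Linfty_zn. Qed.

Lemma mulL2_zn0 f : Linfty f -> f ** zn R 0 = f.
Proof. by move=> lf; rewrite (mulL2C lf (Linfty_zn R 0)) mul_zn0. Qed.

Lemma VopE x : Vop x = zn R (-1) ** conjL2 x.
Proof.
have cV : cLfun 2%:E (fun t => (zfun t)^*%C * (x t)^*%C).
  apply: (cLfun2_ae_eq _
    (cLfunM (Linfty_zn R (-1)) (cLfun2_conj (L2repr_cLfun x)))).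
    apply: cmeasurableM; apply: cmeasurable_conj; last by have [] := L2repr_cLfun x.
    by have := measurable_zfunX R 1; under eq_fun do rewrite expr1z.
  apply: filterS (zn_ae R (-1)) => t ->.
  by rewrite -zfunX_conj expr1z.
apply: L2_ext; apply: filterS3 (toL2_ae cV)
  (mulL2_ae (conjL2 x) (Linfty_zn R (-1))) (filterI (zn_ae R (-1)) (conjL2_ae x)).
by move=> t -> -> [-> ->]; rewrite -[zfun t ^ -1]zfunX_conj expr1z.
Qed.

Lemma inner_mul f x y : Linfty f -> inner (f ** x) y = inner x (conjL2 f ** y).
Proof.
move=> lf; have lf' := Linfty_conj lf.
apply: cintegral_ae_eq; [exact/cintegrable_measurable/inner_integrable..|].
apply: filterS3 (mulL2_ae x lf) (mulL2_ae y lf') (conjL2_ae f) => t -> -> ->.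
by rewrite conjcM conjcK mulrA [f t * _]mulrC.
Qed.

Lemma inner_conj x y : inner (conjL2 x) y = (inner x (conjL2 y))^*%C.
Proof.
rewrite -cintegral_conj; last exact: inner_integrable.
apply: cintegral_ae_eq; [exact/cintegrable_measurable/inner_integrable| |].
  by apply/cintegrable_measurable/cintegrable_conj/inner_integrable.
apply: filterS2 (conjL2_ae x) (conjL2_ae y) => t -> ->.
by rewrite conjcM conjcK.
Qed.

Lemma coef_mul_zn m x n : coef (zn R m ** x) n = coef x (n - m).
Proof.
by rewrite !coefE inner_mul ?conj_zn ?mul_zn 1?addrC//; exact: Linfty_zn.
Qed.

Lemma coef_conj x n : coef (conjL2 x) n = (coef x (- n))^*%C.
Proof. by rewrite !coefE inner_conj conj_zn. Qed.

Lemma coef_mul_conj f x n : Linfty f ->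
  coef (f ** x) n = inner x (zn R n ** conjL2 f).
Proof.
move=> lf; rewrite coefE (inner_mul _ _ lf).
by rewrite (mulL2C (Linfty_zn R n) (Linfty_conj lf)).
Qed.

End fourier_coefs.

(** * The Riesz projection *)

Section hardy_decomposition.
Context (R : realType).
Local Open Scope complex_scope.
Local Notation coef := (@fourier_coef R).
Local Notation z := (zn R).
Implicit Types (x y w f g h : L2 R) (a : R[i]) (n m : int).

(** This turns out to be the orthogonal complement of the Hardy space. *)
Definition antihardy : set (L2 R) :=
  [set x | forall n : int, 0 <= n -> coef x n = 0].

Lemma hardy_zn n : 0 <= n -> hardy2 (z n).
Proof.
move=> n0 m m0; rewrite coef_zn; case: eqP => // nm.
by move: m0; rewrite -nm ltNge n0.
Qed.

Lemma antihardy_zn n : n < 0 -> antihardy (z n).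
Proof.
move=> n0 m m0; rewrite coef_zn; case: eqP => // nm.
by move: n0; rewrite nm ltNge m0.
Qed.

(** Projecting onto the orthogonal complement of [antihardy] gives a decomposition
without using that the Hardy space is this complement; [hardy_antihardy_orth]
then deduces it from uniqueness of Fourier coefficients. *)
Lemma hardy_decomposition x : exists y, [/\ hardy2 y, antihardy (x - y) &
  forall w, antihardy w -> inner y w = 0].
Proof.
have [y [yW yM]] := orthogonal_decomposition antihardy x.
exists y; split => // [n n0|n n0].
  by rewrite coefE yW//; exact: antihardy_zn.
rewrite coefE yM// => w ww.
by rewrite innerC -coefE ww// conjc0.
Qed.

Lemma hardy_antihardy0 x : hardy2 x -> antihardy x -> x = 0.
Proof.
move=> hx ax; apply: coef_ext => n; rewrite coef0.
by have [n0|n0] := leP 0 n; [exact: ax|exact: hx].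
Qed.

Lemma hardy_antihardy_orth x w : hardy2 x -> antihardy w -> inner x w = 0.
Proof.
move=> hx aw; have [y [hy axy yW]] := hardy_decomposition x.
have /eqP : x - y = 0.
  by apply: hardy_antihardy0 => // n n0; rewrite coefB hx// hy// subrr.
by rewrite subr_eq0 => /eqP ->; exact: yW.
Qed.

(** The definition of [Pplus] chooses a projection if there is one; this is where
existence enters. *)
Lemma PplusP x : hardy2 (Pplus x) /\ antihardy (Pminus x).
Proof.
have : [set y | hardy2 y /\ forall h, hardy2 h -> inner (x - y) h = 0] (Pplus x).
  apply: xgetPex; have [y [hy axy _]] := hardy_decomposition x.
  by exists y; split => // h hh; rewrite innerC hardy_antihardy_orth// conjc0.
move=> [hP oP]; split => // n n0.
by rewrite coefE oP//; exact: hardy_zn.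
Qed.

Lemma coef_Pplus x n : coef (Pplus x) n = if 0 <= n then coef x n else 0.
Proof.
have [hp ap] := PplusP x; case: leP => n0; last exact: hp.
by have := ap n n0; rewrite coefB => /eqP; rewrite subr_eq0 => /eqP.
Qed.

Lemma coef_Pminus x n : coef (Pminus x) n = if 0 <= n then 0 else coef x n.
Proof. by rewrite coefB coef_Pplus; case: ifP; rewrite ?subrr ?subr0. Qed.

Lemma Pplus_add_Pminus x : Pplus x + Pminus x = x.
Proof. by rewrite addrC subrK. Qed.

End hardy_decomposition.

(** * Projections, multiplications and the shift *)

Section riesz_projections.
Context (R : realType).
Local Open Scope complex_scope.
Local Notation coef := (@fourier_coef R).
Local Notation z := (zn R).
Local Notation P := (@Pplus R).
Local Notation Q := (@Pminus R).
Implicit Types (x y w p q f g h : L2 R) (a : R[i]) (n m : int).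

(* Conversion must not compare two classes by computing with representatives. *)
Local Opaque Linfty mulL2 conjL2 Pplus Vop zn.

Lemma PplusD x y : P (x + y) = P x + P y.
Proof.
by apply: coef_ext => n; rewrite coefD !coef_Pplus coefD; case: ifP; rewrite ?addr0.
Qed.

Lemma PplusZ a x : P (a *: x) = a *: P x.
Proof.
by apply: coef_ext => n; rewrite coefZ !coef_Pplus coefZ; case: ifP; rewrite ?mulr0.
Qed.

Lemma PplusB x y : P (x - y) = P x - P y.
Proof. by rewrite -(scaleN1r y) PplusD PplusZ scaleN1r. Qed.

Lemma PminusD x y : Q (x + y) = Q x + Q y.
Proof. by rewrite /Pminus PplusD opprD addrACA. Qed.

Lemma PminusZ a x : Q (a *: x) = a *: Q x.
Proof. by rewrite /Pminus PplusZ scalerBr. Qed.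

Lemma PminusB x y : Q (x - y) = Q x - Q y.
Proof. by rewrite -(scaleN1r y) PminusD PminusZ scaleN1r. Qed.

Lemma Pminus_eq0 x : hardy2 x -> Q x = 0.
Proof.
move=> hx; apply: coef_ext => n; rewrite coef_Pminus coef0; case: leP => // n0.
exact: hx.
Qed.

Lemma Pplus_eq0 x : antihardy x -> P x = 0.
Proof.
move=> ax; apply: coef_ext => n; rewrite coef_Pplus coef0; case: leP => // n0.
exact: ax.
Qed.

Lemma Pplus_id x : hardy2 x -> P x = x.
Proof. by move=> hx; rewrite -[RHS]Pplus_add_Pminus (Pminus_eq0 hx) addr0. Qed.

Lemma Pminus_id x : antihardy x -> Q x = x.
Proof. by move=> ax; rewrite /Pminus Pplus_eq0// subr0. Qed.

Lemma hardy_Pplus x : hardy2 (P x). Proof. by case: (PplusP x). Qed.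

Lemma antihardy_Pminus x : antihardy (Q x). Proof. by case: (PplusP x). Qed.

Lemma Pminus0_hardy x : Q x = 0 -> hardy2 x.
Proof. by move=> Q0; rewrite -(Pplus_add_Pminus x) Q0 addr0; exact: hardy_Pplus. Qed.

Lemma inner_Pplus x w : inner x (P w) = inner (P x) w.
Proof.
rewrite -{1}(Pplus_add_Pminus x) -{2}(Pplus_add_Pminus w) innerDl innerDr.
rewrite (hardy_antihardy_orth (hardy_Pplus x) (antihardy_Pminus w)) addr0.
rewrite innerC [inner (Q x) _]innerC.
by rewrite (hardy_antihardy_orth (hardy_Pplus w) (antihardy_Pminus x)) conjc0 addr0.
Qed.

Lemma inner_Pminus x w : inner x (Q w) = inner (Q x) w.
Proof. by rewrite /Pminus innerBr innerBl inner_Pplus. Qed.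

(** * Multiplication by bounded analytic and antianalytic functions *)

(** A negative coefficient of [h x] is the scalar product of [x] with the product of
a power of [z] and the conjugate of [h], whose spectrum is negative. *)
Lemma hardy_mul h x : Hinfty h -> hardy2 x -> hardy2 (h ** x).
Proof.
move=> [lh hh] hx n n0; rewrite coef_mul_conj//.
apply: hardy_antihardy_orth => // m m0.
rewrite coef_mul_zn coef_conj hh ?conjc0// opprB subr_lt0.
exact: lt_le_trans m0.
Qed.

Lemma antihardy_mul h w : Linfty h -> hardy2 (conjL2 h) -> antihardy w ->
  antihardy (h ** w).
Proof.
move=> lh hh aw n n0; have lh' := Linfty_conj lh.
rewrite coef_mul_conj// innerC hardy_antihardy_orth ?conjc0//.
rewrite (mulL2C (Linfty_zn R n) lh'); apply: hardy_mul => //.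
exact: hardy_zn.
Qed.

Lemma hardy_mul_zn n x : 0 <= n -> hardy2 x -> hardy2 (z n ** x).
Proof.
move=> n0; apply: hardy_mul; split; [exact: Linfty_zn|exact: hardy_zn].
Qed.

Lemma antihardy_mul_zn n x : n <= 0 -> antihardy x -> antihardy (z n ** x).
Proof.
move=> n0 ax m m0; rewrite coef_mul_zn ax// subr_ge0.
exact: le_trans m0.
Qed.

(** A Hankel operator vanishes exactly when its symbol is analytic: apply it to the
constant [1]. *)
Lemma Pminus_mul_Pplus f : Linfty f ->
  hardy2 f <-> forall x, Q (f ** P x) = 0.
Proof.
move=> lf; split => [hf x|Q0].
  by apply: Pminus_eq0; apply: hardy_mul; [split|exact: hardy_Pplus].
apply: Pminus0_hardy; have := Q0 (z 0).
by rewrite Pplus_id ?mulL2_zn0//; exact: hardy_zn.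
Qed.

(** The dual statement is tested on the inverse of [z], the first element of the
complement. *)
Lemma Pplus_mul_Pminus f : Linfty f ->
  hardy2 (conjL2 f) <-> forall x, P (f ** Q x) = 0.
Proof.
move=> lf; split => [hf x|P0 n n0].
  by apply: Pplus_eq0; apply: antihardy_mul => //; exact: antihardy_Pminus.
have := congr1 (fun x => coef x (- n - 1)) (P0 (z (-1))).
rewrite Pminus_id; last exact: antihardy_zn.
rewrite (mulL2C lf (Linfty_zn R (-1))) coef_Pplus coef_mul_zn coef0 opprK subrK.
have -> : 0 <= - n - 1.
  by rewrite subr_ge0 -[1]add0r lezD1 oppr_gt0.
by move=> f0; rewrite coef_conj f0 conjc0.
Qed.

(** * The shift *)

(** The shift commutes with the projection up to an operator of rank one. *)
Lemma Pplus_shift y : P (z 1 ** y) = z 1 ** P y + coef y (-1) *: z 0.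
Proof.
apply: coef_ext => n.
rewrite coefD coefZ coef_zn coef_Pplus !coef_mul_zn coef_Pplus subr_ge0.
have [->|n0] := eqVneq n 0; first by rewrite lexx /= mulr1 !add0r.
rewrite mulr0 addr0.
by rewrite (_ : (0 <= n) = (1 <= n))//; lia.
Qed.

Lemma Pminus_backshift y :
  Q (z (-1) ** y) = z (-1) ** Q y + coef y 0 *: z (-1).
Proof.
apply: coef_ext => n.
rewrite coefD coefZ coef_zn coef_Pminus !coef_mul_zn coef_Pminus opprK.
have [->|n0] := eqVneq n (-1); first by rewrite addNr lexx /= mulr1 add0r.
rewrite mulr0 addr0.
by rewrite (_ : (0 <= n) = (0 <= n + 1))//; lia.
Qed.

(** * Symbols and operators *)

(** The operators are provided by existence statements, so that the algebra below
deals with abstract linear maps. *)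
Lemma mulL2_linear f : Linfty f ->
  exists A : {linear L2 R -> L2 R}, forall x, A x = f ** x.
Proof.
move=> lf; have lin : linear (mulL2 f).
  by move=> a x y; rewrite mulL2Dr// mulL2Zr.
pose m := GRing.isLinear.Build R[i] (L2 R) (L2 R) *:%R (mulL2 f) lin.
by exists (HB.pack_for {linear L2 R -> L2 R} (mulL2 f) m).
Qed.

Lemma Pplus_linear : exists A : {linear L2 R -> L2 R}, forall x, A x = P x.
Proof.
have lin : linear P by move=> a x y; rewrite PplusD PplusZ.
pose m := GRing.isLinear.Build R[i] (L2 R) (L2 R) *:%R P lin.
by exists (HB.pack_for {linear L2 R -> L2 R} P m).
Qed.

Lemma Pminus_linear : exists A : {linear L2 R -> L2 R}, forall x, A x = Q x.
Proof.
have lin : linear Q by move=> a x y; rewrite PminusD PminusZ.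
pose m := GRing.isLinear.Build R[i] (L2 R) (L2 R) *:%R Q lin.
by exists (HB.pack_for {linear L2 R -> L2 R} Q m).
Qed.

(** A linear condition on symbols modulo [Hinfty] is a linear relation between
Hankel operators. *)
Lemma hardy_relation f g h a b : Linfty f -> Linfty g -> Linfty h ->
  hardy2 (f - a *: g - b *: h) <->
  forall x, Q (f ** P x) = a *: Q (g ** P x) + b *: Q (h ** P x).
Proof.
move=> lf lg lh; have la := LinftyZ a lg; have lb := LinftyZ b lh.
have lfa := LinftyB lf la.
rewrite (Pminus_mul_Pplus (LinftyB lfa lb)).
have E x : Q ((f - a *: g - b *: h) ** P x) =
    Q (f ** P x) - (a *: Q (g ** P x) + b *: Q (h ** P x)).
  rewrite (mulL2Bl _ lfa lb) (mulL2Bl _ lf la) (mulL2Zl _ _ lg) (mulL2Zl _ _ lh).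
  by rewrite !PminusB !PminusZ opprD addrA.
split=> H x; have := H x; rewrite E.
  by move/eqP; rewrite subr_eq0 => /eqP.
by move=> ->; rewrite subrr.
Qed.

Lemma antihardy_relation f g h a b : Linfty f -> Linfty g -> Linfty h ->
  hardy2 (conjL2 f - a^*%C *: conjL2 g - b^*%C *: conjL2 h) <->
  forall x, P (f ** Q x) = a *: P (g ** Q x) + b *: P (h ** Q x).
Proof.
move=> lf lg lh; have la := LinftyZ a lg; have lb := LinftyZ b lh.
have lfa := LinftyB lf la.
rewrite -!conjL2Z -!conjL2B (Pplus_mul_Pminus (LinftyB lfa lb)).
have E x : P ((f - a *: g - b *: h) ** Q x) =
    P (f ** Q x) - (a *: P (g ** Q x) + b *: P (h ** Q x)).
  rewrite (mulL2Bl _ lfa lb) (mulL2Bl _ lf la) (mulL2Zl _ _ lg) (mulL2Zl _ _ lh).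
  by rewrite !PplusB !PplusZ opprD addrA.
split=> H x; have := H x; rewrite E.
  by move/eqP; rewrite subr_eq0 => /eqP.
by move=> ->; rewrite subrr.
Qed.

Lemma inner_inj u v : (forall x, inner x u = inner x v) -> u = v.
Proof.
move=> uv; apply/eqP; rewrite -subr_eq0; apply/eqP; apply: sqnorm_eq0.
by rewrite /sqnorm innerBr uv subrr.
Qed.

(** * The anti-unitary operator [V] *)

(** The vectors of the tensors: [V] exchanges the Hardy space and its complement. *)
Lemma Vop_Pminus_conj f : Linfty f -> Vop (Q (conjL2 f)) = P (f ** z (-1)).
Proof.
move=> lf; rewrite (mulL2C lf (Linfty_zn R (-1))).
apply: coef_ext => n; rewrite VopE coef_mul_zn coef_conj coef_Pminus coef_conj.
rewrite coef_Pplus coef_mul_zn !opprK.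
by case: (leP 0 n) => n0; case: leP => n1; rewrite ?conjcK ?conjc0//; lia.
Qed.

Lemma inner_Vop_Pminus f x : Linfty f -> inner x (Vop (Q f)) = coef (f ** P x) (-1).
Proof.
move=> lf; rewrite -{1}(conjL2K f) Vop_Pminus_conj; last exact: Linfty_conj.
rewrite inner_Pplus (coef_mul_conj _ _ lf).
by rewrite (mulL2C (Linfty_zn R (-1)) (Linfty_conj lf)).
Qed.

Lemma inner_Pminus_conj f x : Linfty f ->
  inner x (Q (conjL2 f)) = coef (f ** Q x) 0.
Proof. by move=> lf; rewrite inner_Pminus (coef_mul_conj _ _ lf) mul_zn0. Qed.

Lemma Vop_Pminus_eq0 f : Vop (Q f) = 0 -> hardy2 f.
Proof.
move=> V0; apply: Pminus0_hardy; apply: coef_ext => n.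
have := congr1 (fun x => (coef x (- n - 1))^*%C) V0.
rewrite VopE coef_mul_zn coef_conj opprK subrK opprK conjcK coef0 conjc0.
by move=> ->; rewrite coef0.
Qed.

Lemma Vop_PminusD f g : Vop (Q (f + g)) = Vop (Q f) + Vop (Q g).
Proof. by rewrite PminusD !VopE conjL2D mulL2Dr//; exact: Linfty_zn. Qed.

Lemma Vop_PminusZ a f : Vop (Q (a *: f)) = a^*%C *: Vop (Q f).
Proof. by rewrite PminusZ !VopE conjL2Z mulL2Zr//; exact: Linfty_zn. Qed.

Lemma Vop_PminusB f g : Vop (Q (f - g)) = Vop (Q f) - Vop (Q g).
Proof. by rewrite PminusB !VopE conjL2B mulL2Br//; exact: Linfty_zn. Qed.

Lemma hardy_of_Pminus f g h a b : Q f = a *: Q g + b *: Q h ->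
  hardy2 (f - a *: g - b *: h).
Proof.
move=> e; apply: Pminus0_hardy.
by rewrite !PminusB !PminusZ e -addrA -opprD subrr.
Qed.

Lemma hardy_of_Pminus' f g h a b : Q f = a *: Q g - b *: Q h ->
  hardy2 (f - a *: g + b *: h).
Proof.
move=> e; apply: Pminus0_hardy.
by rewrite PminusD PminusB !PminusZ e addrAC subrK subrr.
Qed.

Lemma hardy_of_Vop f g h a b : Vop (Q f) = a *: Vop (Q g) + b *: Vop (Q h) ->
  hardy2 (f - a^*%C *: g - b^*%C *: h).
Proof.
move=> e; apply: Vop_Pminus_eq0.
by rewrite !Vop_PminusB !Vop_PminusZ !conjcK e -addrA -opprD subrr.
Qed.

Lemma hardy_of_Vop' f g h a b :
  Vop (Q f) = a^*%C *: Vop (Q g) - b^*%C *: Vop (Q h) ->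
  hardy2 (f - a *: g + b *: h).
Proof.
move=> e; apply: Vop_Pminus_eq0.
by rewrite Vop_PminusD Vop_PminusB !Vop_PminusZ e addrAC subrK subrr.
Qed.

End riesz_projections.

(** * The commutator, entry by entry *)

Section block_calculus.
Variables (K : fieldType) (E : lmodType K) (P Q : {linear E -> E}).
Hypotheses (PP : forall x, P (P x) = P x) (PDQ : forall x, P x + Q x = x).

Let PQ x : P (Q x) = 0.
Proof. by apply: (addrI (P (P x))); rewrite -linearD PDQ PP addr0. Qed.

Let QP x : Q (P x) = 0.
Proof. by apply: (addrI (P (P x))); rewrite PDQ PP addr0. Qed.

Let QQ x : Q (Q x) = Q x.
Proof. by rewrite -[RHS]PDQ PQ add0r. Qed.

Definition block_op (f g u v : E -> E) x :=
  P (f (P x)) + Q (g (P x)) + P (u (Q x)) + Q (v (Q x)).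

Variables (f1 g1 u1 v1 f2 g2 u2 v2 : {linear E -> E}).

(** The entries, in the order from [P] to [P], from [P] to [Q], from [Q] to [P] and
from [Q] to [Q]. *)
Definition blocks_commute := [/\
  forall x, P (f1 (P (f2 (P x)))) + P (u1 (Q (g2 (P x)))) =
            P (f2 (P (f1 (P x)))) + P (u2 (Q (g1 (P x)))),
  forall x, Q (g1 (P (f2 (P x)))) + Q (v1 (Q (g2 (P x)))) =
            Q (g2 (P (f1 (P x)))) + Q (v2 (Q (g1 (P x)))),
  forall x, P (f1 (P (u2 (Q x)))) + P (u1 (Q (v2 (Q x)))) =
            P (f2 (P (u1 (Q x)))) + P (u2 (Q (v1 (Q x)))) &
  forall x, Q (g1 (P (u2 (Q x)))) + Q (v1 (Q (v2 (Q x)))) =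
            Q (g2 (P (u1 (Q x)))) + Q (v2 (Q (v1 (Q x))))].

Let P_block (f g u v : E -> E) x : P (block_op f g u v x) = P (f (P x)) + P (u (Q x)).
Proof. by rewrite /block_op !linearD /= !PP !PQ !addr0. Qed.

Let Q_block (f g u v : E -> E) x : Q (block_op f g u v x) = Q (g (P x)) + Q (v (Q x)).
Proof. by rewrite /block_op !linearD /= !QQ !QP add0r addr0. Qed.

Lemma block_op_commP :
  (forall x, block_op f1 g1 u1 v1 (block_op f2 g2 u2 v2 x) =
             block_op f2 g2 u2 v2 (block_op f1 g1 u1 v1 x)) <-> blocks_commute.
Proof.
split=> [com|[h1 h2 h3 h4] x].
  have hP x : P (f1 (P (f2 (P x)))) + P (f1 (P (u2 (Q x)))) +
      (P (u1 (Q (g2 (P x)))) + P (u1 (Q (v2 (Q x))))) =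
      P (f2 (P (f1 (P x)))) + P (f2 (P (u1 (Q x)))) +
      (P (u2 (Q (g1 (P x)))) + P (u2 (Q (v1 (Q x))))).
    by have := congr1 P (com x); rewrite !P_block !Q_block !linearD.
  have hQ x : Q (g1 (P (f2 (P x)))) + Q (g1 (P (u2 (Q x)))) +
      (Q (v1 (Q (g2 (P x)))) + Q (v1 (Q (v2 (Q x))))) =
      Q (g2 (P (f1 (P x)))) + Q (g2 (P (u1 (Q x)))) +
      (Q (v2 (Q (g1 (P x)))) + Q (v2 (Q (v1 (Q x))))).
    by have := congr1 Q (com x); rewrite !Q_block !P_block !linearD.
  split=> x.
  - by have := hP (P x); rewrite !PP !QP !linear0 !addr0.
  - by have := hQ (P x); rewrite !PP !QP !linear0 !addr0.
  - by have := hP (Q x); rewrite !PQ !QQ !linear0 !add0r.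
  - by have := hQ (Q x); rewrite !PQ !QQ !linear0 !add0r.
rewrite -[LHS]PDQ -[RHS]PDQ !P_block !Q_block !P_block !linearD /=.
by congr (_ + _); rewrite addrACA ?h1 ?h3 ?h2 ?h4 addrACA.
Qed.

End block_calculus.

(** The two entries below are treated for one side of the decomposition; the
other side follows by exchanging [P] with [Q], [f] with [v] and [g] with [u]. *)
Section entries.
Variables (K : fieldType) (E : lmodType K) (P Q : {linear E -> E}).
Hypotheses (PDQ : forall x, P x + Q x = x).
Variables (f1 g1 u1 v1 f2 g2 u2 v2 : {linear E -> E}) (a b c d : K).

Let viaP (A B : {linear E -> E}) y : A (B (P y)) = A (B y) - A (B (Q y)).
Proof. by rewrite -{2}(PDQ y) !linearD addrK. Qed.

Let viaQ (A B : {linear E -> E}) y : A (B (Q y)) = A (B y) - A (B (P y)).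
Proof. by rewrite viaP opprB addrC subrK. Qed.

Let shuffle4 (V : zmodType) (A B C D : V) :
  (A + B) - (C + D) = (B - D) + (- C + A).
Proof. by rewrite [- C + A]addrC opprD [RHS]addrACA [B + A]addrC [- D - C]addrC. Qed.

Let shuffle10 (V : zmodType) (A A' B B' C C' D D' X Y : V) :
  A - A' + (B - B') + (X + (- C + C' + (- D + D'))) +
    (- Y + (A' - C') + (- D' + B')) =
  X - Y + A + B - C - D.
Proof.
rewrite !addrA [LHS](ACl (5*10*1*3*6*8*(2*11)*(4*14)*(7*12)*(13*9)))/=.
by rewrite !addNr !subrr !addr0.
Qed.

Hypotheses
  (f1p : forall x, Q (f1 (P x)) = a *: Q (f2 (P x)) - c *: Q (g2 (P x)))
  (g1p : forall x, Q (g1 (P x)) = d *: Q (g2 (P x)) - b *: Q (f2 (P x))).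

(** Replacing an inner projection by the identity minus the other one leaves
products of two symbols, equal by [f12]; the relations express the rest by
products of Hankel operators of the second symbol, which cancel. *)
Lemma diagonal_entry (f12 : forall y, f1 (f2 y) = f2 (f1 y))
    (f1q : forall x, P (f1 (Q x)) = a *: P (f2 (Q x)) + b *: P (u2 (Q x)))
    (u1q : forall x, P (u1 (Q x)) = c *: P (f2 (Q x)) + d *: P (u2 (Q x))) x :
  P (f1 (P (f2 (P x)))) + P (u1 (Q (g2 (P x)))) =
  P (f2 (P (f1 (P x)))) + P (u2 (Q (g1 (P x)))).
Proof.
rewrite (viaP P f1) (viaP P f2) f12 -!addrA; congr (_ + _).
rewrite addrC [RHS]addrC f1p g1p f1q u1q !linearB !linearZ /= !scalerN !opprK.
exact: shuffle4.
Qed.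

Definition mixed_symbol y :=
  v1 (g2 y) - g2 (f1 y) + a *: g2 (f2 y) + b *: v2 (f2 y)
  - c *: g2 (g2 y) - d *: v2 (g2 y).

(** The pieces with [P] and with [Q] between two given symbols have the same
coefficient, so they add up to the product of the symbols. *)
Lemma mixed_entry
    (g1p' : forall x, Q (g1 (P x)) = a *: Q (g2 (P x)) + b *: Q (v2 (P x)))
    (v1p : forall x, Q (v1 (P x)) = c *: Q (g2 (P x)) + d *: Q (v2 (P x))) x :
  Q (g1 (P (f2 (P x)))) + Q (v1 (Q (g2 (P x)))) -
  (Q (g2 (P (f1 (P x)))) + Q (v2 (Q (g1 (P x))))) =
  Q (mixed_symbol (P x)).
Proof.
rewrite /mixed_symbol [Q (g1 (P (f2 _)))]g1p' g1p (viaQ Q v1) v1p.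
rewrite [Q (g2 (P (f1 _)))](viaP Q g2) f1p.
rewrite !(linearB, linearD, linearZ) /= !scalerN !opprK.
rewrite (viaP Q g2 (f2 _)) (viaP Q v2 (f2 _)) (viaP Q g2 (g2 _)) (viaP Q v2 (g2 _)).
by rewrite !scalerBr !opprD !opprK; exact: shuffle10.
Qed.

End entries.

(** * The entries under the shift *)

Section shifted_entries.
Variables (K : fieldType) (E : lmodType K) (P Q S S' : {linear E -> E}).
Variables (phi : E -> K) (e : E).
Hypothesis (PDQ : forall x, P x + Q x = x).
Hypotheses (SK : forall x, S' (S x) = x) (S'K : forall x, S (S' x) = x).
Hypotheses (PSP : forall x, Q (S (P x)) = 0) (QSQ : forall x, P (S' (Q x)) = 0).
Hypothesis shift : forall y, P (S y) = S (P y) + phi y *: e.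
Variables (f1 g1 u1 v1 f2 g2 u2 v2 : {linear E -> E}).

Let Qshift y : Q (S y) = S (Q y) - phi y *: e.
Proof.
apply: (addrI (P (S y))); rewrite PDQ shift -{1}(PDQ y) linearD /=.
by rewrite addrACA subrr addr0.
Qed.

Let S'P w : P (S' (P w)) = P (S' w).
Proof. by rewrite -[in RHS](PDQ w) !linearD /= QSQ addr0. Qed.

Let SQ w : Q (S (Q w)) = Q (S w).
Proof. by rewrite -[in RHS](PDQ w) !linearD /= PSP add0r. Qed.

Let PSPx x : P (S (P x)) = S (P x).
Proof. by rewrite -[RHS]PDQ PSP addr0. Qed.

Let shift_comm (f : {linear E -> E}) : (forall y, f (S y) = S (f y)) ->
  forall y, S' (f y) = f (S' y).
Proof. by move=> fS y; rewrite -{1}(S'K y) fS SK. Qed.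

Let PfP (f g : {linear E -> E}) x : (forall y, f (S y) = S (f y)) ->
  (forall y, g (S y) = S (g y)) ->
  P (S' (P (f (P (g (S x)))))) = P (f (P (g x))) + phi (g x) *: P (f (S' e)).
Proof.
by move=> fS gS; rewrite S'P (shift_comm fS) gS shift !linearD /= SK !linearZ.
Qed.

Let PfQ (f g : {linear E -> E}) x : (forall y, f (S y) = S (f y)) ->
  (forall y, g (S y) = S (g y)) ->
  P (S' (P (f (Q (g (S x)))))) = P (f (Q (g x))) - phi (g x) *: P (f (S' e)).
Proof.
by move=> fS gS; rewrite S'P (shift_comm fS) gS Qshift !linearB /= SK !linearZ.
Qed.

Let QfP (f g : {linear E -> E}) x : (forall y, f (S y) = S (f y)) ->
  (forall y, g (S y) = S (g y)) ->
  Q (f (P (g (S x)))) = Q (S (Q (f (P (g x))))) + phi (g x) *: Q (f e).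
Proof. by move=> fS gS; rewrite SQ gS shift !linearD /= fS !linearZ. Qed.

Let QfQ (f g : {linear E -> E}) x : (forall y, f (S y) = S (f y)) ->
  (forall y, g (S y) = S (g y)) ->
  Q (f (Q (g (S x)))) = Q (S (Q (f (Q (g x))))) - phi (g x) *: Q (f e).
Proof. by move=> fS gS; rewrite SQ gS Qshift !linearB /= fS !linearZ. Qed.

Let cancel_sum (V : zmodType) (A B A' B' X Y X' Y' : V) : A + B = A' + B' ->
  (A + X) + (B - Y) = (A' + X') + (B' - Y') -> X - Y = X' - Y'.
Proof.
by move=> AB H; apply: (addrI (A + B)); rewrite [LHS]addrACA H AB addrACA.
Qed.

Hypotheses (f1S : forall y, f1 (S y) = S (f1 y)) (f2S : forall y, f2 (S y) = S (f2 y))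
  (g1S : forall y, g1 (S y) = S (g1 y)) (g2S : forall y, g2 (S y) = S (g2 y))
  (u1S : forall y, u1 (S y) = S (u1 y)) (u2S : forall y, u2 (S y) = S (u2 y))
  (v1S : forall y, v1 (S y) = S (v1 y)) (v2S : forall y, v2 (S y) = S (v2 y)).

(** The difference between an entry compressed by the shift and the entry itself
comes from the rank one defect in [shift] and [Qshift], with opposite signs. *)
Lemma diagonal_entry_shift :
  (forall x, P (f1 (P (f2 (P x)))) + P (u1 (Q (g2 (P x)))) =
             P (f2 (P (f1 (P x)))) + P (u2 (Q (g1 (P x))))) ->
  forall x, phi (f2 (P x)) *: P (f1 (S' e)) - phi (g2 (P x)) *: P (u1 (S' e)) =
            phi (f1 (P x)) *: P (f2 (S' e)) - phi (g1 (P x)) *: P (u2 (S' e)).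
Proof.
move=> h x; apply: (cancel_sum (h x)).
have := congr1 (fun y => P (S' y)) (h (S (P x))).
by rewrite /= !linearD /= PSPx !PfP ?PfQ.
Qed.

Lemma mixed_entry_shift :
  (forall x, Q (g1 (P (f2 (P x)))) + Q (v1 (Q (g2 (P x)))) =
             Q (g2 (P (f1 (P x)))) + Q (v2 (Q (g1 (P x))))) ->
  forall x, phi (f2 (P x)) *: Q (g1 e) - phi (g2 (P x)) *: Q (v1 e) =
            phi (f1 (P x)) *: Q (g2 e) - phi (g1 (P x)) *: Q (v2 e).
Proof.
move=> h x.
have hx := congr1 (fun y => Q (S y)) (h x); rewrite /= !linearD /= in hx.
by apply: (cancel_sum hx); have := h (S (P x)); rewrite PSPx !QfP ?QfQ.
Qed.

End shifted_entries.

(** * Operators of rank two *)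

Section rank_two.
Variables (K : fieldType) (U W : lmodType K).
Implicit Types (l : U -> K) (p : W).

Definition linear_form l := forall k x y, l (k *: x + y) = k * l x + l y.

Lemma linear_formE l k x k' y : linear_form l ->
  l (k *: x + k' *: y) = k * l x + k' * l y.
Proof.
move=> ll; have l0 : l 0 = 0.
  by have := ll 1 0 0; rewrite scaler0 addr0 mul1r => /(congr1 (+%R^~ (- l 0)));
    rewrite addrK subrr.
by rewrite ll -[k' *: y]addr0 ll l0 addr0.
Qed.

Let eliminate (k m n n' : K) p1 p2 :
  k *: (m *: p1 - n *: p2) - m *: (k *: p1 - n' *: p2) = (m * n' - k * n) *: p2.
Proof.
rewrite !scalerBr !scalerA scalerBl [k * m]mulrC opprB addrC addrA subrK.
by [].
Qed.

Let eliminate' (k m n n' : K) p1 p2 :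
  k *: (n *: p1 - m *: p2) - m *: (n' *: p1 - k *: p2) = (k * n - m * n') *: p1.
Proof.
rewrite !scalerBr !scalerA scalerBl [k * m]mulrC opprB.
by rewrite addrA subrK.
Qed.

(** The values [e 0] and [e 1] are the images of [p1] and [p2] under a matrix of
values of [l1] and [l2] with determinant [D]; were [D] zero, they would be
dependent. *)
Lemma rank_two_independent l1 l2 p1 p2 : linear_form l1 -> linear_form l2 ->
  has_rank ((fun x => l1 x *: p1) \- (fun x => l2 x *: p2)) 2 ->
  (forall s t : K, s *: p1 + t *: p2 = 0 -> s = 0 /\ t = 0) /\
  (forall s t : K, exists x, l1 x = s /\ l2 x = t).
Proof.
move=> ll1 ll2 [e [eindep eran]].
have eind (s t : K) : s *: e 0 + t *: e 1 = 0 -> s = 0 /\ t = 0.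
  move=> st0; have := eindep (fun i => if i == 0 then s else t).
  rewrite big_ord_recl big_ord1 /= => H.
  rewrite (_ : lift ord0 ord0 = 1) in H; last exact: val_inj.
  have {}H := H st0.
  by split; [exact: (H 0)|exact: (H 1)].
have inran i : exists x, e i = l1 x *: p1 - l2 x *: p2.
  have : range ((fun x => l1 x *: p1) \- (fun x => l2 x *: p2)) (e i).
    rewrite eran; exists (fun j => (j == i)%:R).
    rewrite (bigD1 i)//= eqxx scale1r big1 ?addr0// => j /negbTE ->.
    by rewrite scale0r.
  by case=> x _ <-; exists x.
have [x0 e0] := inran 0; have [x1 e1] := inran 1.
pose D := l1 x0 * l2 x1 - l1 x1 * l2 x0.
have Dp2 : l1 x1 *: e 0 + (- l1 x0) *: e 1 = D *: p2.
  by rewrite e0 e1 scaleNr eliminate.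
have Dp1 : l2 x1 *: e 0 + (- l2 x0) *: e 1 = D *: p1.
  by rewrite e0 e1 scaleNr eliminate' /D [l2 x1 * _]mulrC [l2 x0 * _]mulrC.
have D0 : D != 0.
  apply/eqP => D0; move: Dp1 Dp2; rewrite D0 !scale0r.
  move=> /eind[_ /eqP]; rewrite oppr_eq0 => /eqP l20 /eind[_ /eqP].
  rewrite oppr_eq0 => /eqP l10; have := eind 1 0.
  rewrite scale1r scale0r addr0 e0 l10 l20 !scale0r subr0 => /(_ erefl)[/eqP].
  by rewrite oner_eq0.
split=> s t.
  move=> st0.
  have : D *: (s *: p1 + t *: p2) = 0 by rewrite st0 scaler0.
  rewrite scalerDr !scalerA ![D * _]mulrC -!scalerA -Dp1 -Dp2.
  rewrite !scalerDr !scalerA addrACA -!scalerDl => /eind[s0 t0].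
  have sD : s * D = 0.
    have -> : s * D = l1 x0 * (s * l2 x1 + t * l1 x1) +
      l1 x1 * (s * - l2 x0 + t * - l1 x0) by rewrite /D; ring.
    by rewrite s0 t0 !mulr0 addr0.
  have tD : t * D = 0.
    have -> : t * D = - (l2 x0 * (s * l2 x1 + t * l1 x1) +
      l2 x1 * (s * - l2 x0 + t * - l1 x0)) by rewrite /D; ring.
    by rewrite s0 t0 !mulr0 addr0 oppr0.
  by split; apply/eqP; [move/eqP: sD|move/eqP: tD]; rewrite mulf_eq0 (negbTE D0) orbF.
exists (((s * l2 x1 - t * l1 x1) / D) *: x0 + ((t * l1 x0 - s * l2 x0) / D) *: x1).
by rewrite !linear_formE//; split; move: D0; rewrite /D => D0; field.
Qed.

(** Two equal operators of rank two are related by a change of basis of their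
common range, and the linear forms by the contragredient change. *)
Lemma rank_two_eq l1 l2 m1 m2 p1 p2 r1 r2 :
  linear_form l1 -> linear_form l2 -> linear_form m1 -> linear_form m2 ->
  has_rank ((fun x => l1 x *: p1) \- (fun x => l2 x *: p2)) 2 ->
  has_rank ((fun x => m1 x *: r1) \- (fun x => m2 x *: r2)) 2 ->
  (forall x, l1 x *: p1 - l2 x *: p2 = m1 x *: r1 - m2 x *: r2) ->
  exists a b c d, [/\ p1 = a *: r1 + b *: r2, p2 = c *: r1 + d *: r2,
    forall x, m1 x = a * l1 x - c * l2 x & forall x, m2 x = d * l2 x - b * l1 x].
Proof.
move=> ll1 ll2 lm1 lm2 rk1 rk2 eqT.
have [_ sur] := rank_two_independent ll1 ll2 rk1.
have [ind _] := rank_two_independent lm1 lm2 rk2.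
have [x [x1 x2]] := sur 1 0; have [y [y1 y2]] := sur 0 (-1).
have px := eqT x; rewrite x1 x2 scale1r scale0r subr0 in px.
have py := eqT y; rewrite y1 y2 scaleN1r scale0r opprK add0r in py.
exists (m1 x), (- m2 x), (m1 y), (- m2 y).
have key u : m1 u - (m1 x * l1 u - m1 y * l2 u) = 0 /\
             m2 u - (m2 x * l1 u - m2 y * l2 u) = 0.
  have := eqT u; rewrite px py !scalerBr !scalerA.
  move=> /eqP; rewrite eq_sym -subr_eq0 => /eqP h.
  have /ind[h1 /eqP h2] : (m1 u - (m1 x * l1 u - m1 y * l2 u)) *: r1 +
     (- (m2 u - (m2 x * l1 u - m2 y * l2 u))) *: r2 = 0.
    rewrite -[RHS]h !scaleNr !scalerBl ![l1 u * _]mulrC ![l2 u * _]mulrC.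
    rewrite !opprB !addrA.
    by rewrite [LHS](ACl (1*6*2*5*4*3)).
  by split; [|apply/eqP; rewrite -oppr_eq0].
split; rewrite ?scaleNr// => u; have [/eqP + /eqP] := key u;
  rewrite !subr_eq0 => /eqP k1 /eqP k2.
  by rewrite k1.
by rewrite k2 !mulNr opprK addrC.
Qed.

End rank_two.

(** * Symbols of the mixed entries *)

Section symbols.
Context (R : realType).
Local Open Scope complex_scope.
Implicit Types (x y : L2 R) (a b c d : R[i]).
(* As above, conversion must not compute with representatives. *)
Local Opaque Linfty mulL2 conjL2 Pplus Vop zn.

Section combination.
Variables (x1 x2 x3 x4 x5 x6 : L2 R) (a b c d : R[i]).
Hypotheses (l1 : Linfty x1) (l2 : Linfty x2) (l3 : Linfty x3) (l4 : Linfty x4)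
  (l5 : Linfty x5) (l6 : Linfty x6).

Lemma Linfty_combination :
  Linfty (x1 - x2 + a *: x3 + b *: x4 + c *: x5 + d *: x6).
Proof.
exact: (LinftyD (LinftyD (LinftyD (LinftyD (LinftyB l1 l2) (LinftyZ a l3))
  (LinftyZ b l4)) (LinftyZ c l5)) (LinftyZ d l6)).
Qed.

Lemma mulL2_combination y :
  (x1 - x2 + a *: x3 + b *: x4 + c *: x5 + d *: x6) ** y =
  x1 ** y - x2 ** y + a *: (x3 ** y) + b *: (x4 ** y) + c *: (x5 ** y) + d *: (x6 ** y).
Proof.
have m1 := LinftyB l1 l2; have m2 := LinftyD m1 (LinftyZ a l3).
have m3 := LinftyD m2 (LinftyZ b l4); have m4 := LinftyD m3 (LinftyZ c l5).
rewrite (mulL2Dl _ m4 (LinftyZ d l6)) (mulL2Dl _ m3 (LinftyZ c l5)).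
rewrite (mulL2Dl _ m2 (LinftyZ b l4)) (mulL2Dl _ m1 (LinftyZ a l3)).
by rewrite (mulL2Bl _ l1 l2) (mulL2Zl _ _ l3) (mulL2Zl _ _ l4) (mulL2Zl _ _ l5)
  (mulL2Zl _ _ l6).
Qed.

End combination.

Variables (f1 g1 u1 v1 f2 g2 u2 v2 : L2 R).
Hypotheses (lf1 : Linfty f1) (lg1 : Linfty g1) (lu1 : Linfty u1) (lv1 : Linfty v1)
  (lf2 : Linfty f2) (lg2 : Linfty g2) (lu2 : Linfty u2) (lv2 : Linfty v2).

Definition analytic_symbol a b c d : L2 R :=
  v1 ** g2 - f1 ** g2 + a *: (g2 ** f2) + b *: (v2 ** f2)
  - c *: (g2 ** g2) - d *: (v2 ** g2).

(** Its conjugate is the ninth function of the theorem; it is the symbol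
[mixed_symbol] after the exchange of the two sides. *)
Definition antianalytic_symbol a b c d : L2 R :=
  u2 ** f1 - v1 ** u2 - a *: (u2 ** f2) - b *: (u2 ** u2)
  + c *: (v2 ** f2) + d *: (v2 ** u2).

Lemma Linfty_analytic_symbol a b c d : Linfty (analytic_symbol a b c d).
Proof.
rewrite /analytic_symbol -!scaleNr.
by apply: Linfty_combination; apply: LinftyM.
Qed.

Lemma Linfty_antianalytic_symbol a b c d : Linfty (antianalytic_symbol a b c d).
Proof.
rewrite /antianalytic_symbol -!scaleNr.
by apply: Linfty_combination; apply: LinftyM.
Qed.

Lemma conj_antianalytic_symbol a b c d :
  conjL2 (antianalytic_symbol a b c d) =
  conjL2 u2 ** conjL2 f1 - conjL2 v1 ** conjL2 u2
  - a^*%C *: (conjL2 u2 ** conjL2 f2) - b^*%C *: (conjL2 u2 ** conjL2 u2)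
  + c^*%C *: (conjL2 v2 ** conjL2 f2) + d^*%C *: (conjL2 v2 ** conjL2 u2).
Proof.
rewrite /antianalytic_symbol !(conjL2B, conjL2D, conjL2Z).
by rewrite (conjL2M _ lu2) (conjL2M _ lv1) (conjL2M _ lu2) (conjL2M _ lu2)
  (conjL2M _ lv2) (conjL2M _ lv2).
Qed.

Variables (F1 G1 U1 V1 F2 G2 U2 V2 : {linear L2 R -> L2 R}).
Hypotheses (F1E : forall x, F1 x = f1 ** x) (G1E : forall x, G1 x = g1 ** x)
  (U1E : forall x, U1 x = u1 ** x) (V1E : forall x, V1 x = v1 ** x)
  (F2E : forall x, F2 x = f2 ** x) (G2E : forall x, G2 x = g2 ** x)
  (U2E : forall x, U2 x = u2 ** x) (V2E : forall x, V2 x = v2 ** x).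

Lemma analytic_symbolE a b c d y :
  analytic_symbol a b c d ** y = mixed_symbol F1 V1 F2 G2 V2 a b c d y.
Proof.
rewrite /analytic_symbol -!scaleNr mulL2_combination; try exact: LinftyM.
rewrite -(mulL2A _ lv1 lg2) (mulL2C lf1 lg2) -(mulL2A _ lg2 lf1) -(mulL2A _ lg2 lf2).
rewrite -(mulL2A _ lv2 lf2) -(mulL2A _ lg2 lg2) -(mulL2A _ lv2 lg2).
by rewrite -F1E -F2E -!G2E -V1E -!V2E /mixed_symbol !scaleNr.
Qed.

Lemma antianalytic_symbolE a b c d y :
  antianalytic_symbol a b c d ** y = mixed_symbol V1 F1 V2 U2 F2 d c b a y.
Proof.
rewrite /antianalytic_symbol -!scaleNr mulL2_combination; try exact: LinftyM.
rewrite (mulL2C lu2 lf1) (mulL2C lv1 lu2) (mulL2C lu2 lf2) (mulL2C lv2 lf2) (mulL2C lv2 lu2).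
rewrite -(mulL2A _ lf1 lu2) -(mulL2A _ lu2 lv1) -(mulL2A _ lf2 lu2).
rewrite -(mulL2A _ lu2 lu2) -(mulL2A _ lf2 lv2) -(mulL2A _ lu2 lv2).
rewrite -F1E -!U2E -V1E -!V2E -!F2E /mixed_symbol !scaleNr.
by rewrite [LHS](ACl (1*2*6*5*4*3)).
Qed.

Variables (P Q : {linear L2 R -> L2 R}).
Hypotheses (PE : forall x, P x = Pplus x) (QE : forall x, Q x = Pminus x).

Let PP x : P (P x) = P x.
Proof. by rewrite !PE; apply: Pplus_id; exact: hardy_Pplus. Qed.

Let PDQ x : P x + Q x = x.
Proof. by rewrite PE QE Pplus_add_Pminus. Qed.

Let QPD x : Q x + P x = x.
Proof. by rewrite addrC PDQ. Qed.

Let comm (A B : {linear L2 R -> L2 R}) f g : Linfty f -> Linfty g ->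
  (forall x, A x = f ** x) -> (forall x, B x = g ** x) ->
  forall x, A (B x) = B (A x).
Proof. by move=> lf lg AE BE x; rewrite !AE !BE mulL2CA. Qed.

Section with_constants.
Variables a b c d : R[i].
Hypotheses
  (h1 : hardy2 (conjL2 f1 - a^*%C *: conjL2 f2 - b^*%C *: conjL2 u2))
  (h2 : hardy2 (g1 - a *: g2 - b *: v2))
  (h3 : hardy2 (conjL2 u1 - c^*%C *: conjL2 f2 - d^*%C *: conjL2 u2))
  (h4 : hardy2 (v1 - c *: g2 - d *: v2))
  (h5 : hardy2 (f1 - a *: f2 + c *: g2))
  (h6 : hardy2 (conjL2 u1 - a^*%C *: conjL2 u2 + c^*%C *: conjL2 v2))
  (h7 : hardy2 (g1 + b *: f2 - d *: g2))
  (h8 : hardy2 (conjL2 v1 + b^*%C *: conjL2 u2 - d^*%C *: conjL2 v2)).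

Let f1q x : P (F1 (Q x)) = a *: P (F2 (Q x)) + b *: P (U2 (Q x)).
Proof. by rewrite !PE QE F1E F2E U2E; exact: (antihardy_relation a b lf1 lf2 lu2).1. Qed.

Let g1p x : Q (G1 (P x)) = a *: Q (G2 (P x)) + b *: Q (V2 (P x)).
Proof. by rewrite !QE PE G1E G2E V2E; exact: (hardy_relation a b lg1 lg2 lv2).1. Qed.

Let u1q x : P (U1 (Q x)) = c *: P (F2 (Q x)) + d *: P (U2 (Q x)).
Proof. by rewrite !PE QE U1E F2E U2E; exact: (antihardy_relation c d lu1 lf2 lu2).1. Qed.

Let v1p x : Q (V1 (P x)) = c *: Q (G2 (P x)) + d *: Q (V2 (P x)).
Proof. by rewrite !QE PE V1E G2E V2E; exact: (hardy_relation c d lv1 lg2 lv2).1. Qed.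

Let f1p x : Q (F1 (P x)) = a *: Q (F2 (P x)) - c *: Q (G2 (P x)).
Proof.
rewrite -scaleNr !QE PE F1E F2E G2E; apply: (hardy_relation a (- c) lf1 lf2 lg2).1.
by rewrite scaleNr opprK.
Qed.

Let u1q' x : P (U1 (Q x)) = a *: P (U2 (Q x)) - c *: P (V2 (Q x)).
Proof.
rewrite -scaleNr !PE QE U1E U2E V2E; apply: (antihardy_relation a (- c) lu1 lu2 lv2).1.
by rewrite conjcN scaleNr opprK.
Qed.

Let g1p' x : Q (G1 (P x)) = d *: Q (G2 (P x)) - b *: Q (F2 (P x)).
Proof.
rewrite -scaleNr !QE PE G1E G2E F2E; apply: (hardy_relation d (- b) lg1 lg2 lf2).1.
by rewrite scaleNr opprK addrAC.
Qed.

Let v1q x : P (V1 (Q x)) = d *: P (V2 (Q x)) - b *: P (U2 (Q x)).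
Proof.
rewrite -scaleNr !PE QE V1E V2E U2E; apply: (antihardy_relation d (- b) lv1 lv2 lu2).1.
by rewrite conjcN scaleNr opprK addrAC.
Qed.

Let f1q' x : P (F1 (Q x)) = b *: P (U2 (Q x)) + a *: P (F2 (Q x)).
Proof. by rewrite f1q addrC. Qed.

Let u1q'' x : P (U1 (Q x)) = d *: P (U2 (Q x)) + c *: P (F2 (Q x)).
Proof. by rewrite u1q addrC. Qed.

Let g1p'' x : Q (G1 (P x)) = b *: Q (V2 (P x)) + a *: Q (G2 (P x)).
Proof. by rewrite g1p addrC. Qed.

Let v1p' x : Q (V1 (P x)) = d *: Q (V2 (P x)) + c *: Q (G2 (P x)).
Proof. by rewrite v1p addrC. Qed.

(** Under the eight linear conditions the diagonal entries of the commutator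
vanish, and the other two are Hankel operators whose symbols are the last
function of the theorem and the conjugate of the one before it. *)
Lemma blocks_commuteP : blocks_commute P Q F1 G1 U1 V1 F2 G2 U2 V2 <->
  hardy2 (conjL2 (antianalytic_symbol a b c d)) /\ hardy2 (analytic_symbol a b c d).
Proof.
rewrite (Pplus_mul_Pminus (Linfty_antianalytic_symbol a b c d)).
rewrite (Pminus_mul_Pplus (Linfty_analytic_symbol a b c d)).
have mp := mixed_entry PDQ f1p g1p' g1p v1p.
have pm := mixed_entry QPD v1q u1q' u1q'' f1q'.
split=> [[_ hQP hPQ _]|[hP hQ]].
  split=> x.
    rewrite antianalytic_symbolE -QE -PE -pm.
    by apply/eqP; rewrite subr_eq0 addrC hPQ addrC.
  by rewrite analytic_symbolE -QE -PE -mp hQP subrr.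
split=> x.
- by apply: (diagonal_entry PDQ f1p g1p' _ f1q u1q); exact: comm F1E F2E.
- apply/eqP; rewrite -subr_eq0 mp; apply/eqP.
  by rewrite QE PE -analytic_symbolE hQ.
- rewrite [LHS]addrC [RHS]addrC; apply/eqP; rewrite -subr_eq0 pm; apply/eqP.
  by rewrite QE PE -antianalytic_symbolE hP.
- rewrite [LHS]addrC [RHS]addrC.
  by apply: (diagonal_entry QPD v1q u1q' _ v1p' g1p''); exact: comm V1E V2E.
Qed.

End with_constants.

Lemma RH_commP (H1 H2 : 'M[L2 R]_2) :
  H1 0 0 = f1 -> H1 0 1 = u1 -> H1 1 0 = g1 -> H1 1 1 = v1 ->
  H2 0 0 = f2 -> H2 0 1 = u2 -> H2 1 0 = g2 -> H2 1 1 = v2 ->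
  RH H1 \o RH H2 = RH H2 \o RH H1 <-> blocks_commute P Q F1 G1 U1 V1 F2 G2 U2 V2.
Proof.
move=> e1 e2 e3 e4 e5 e6 e7 e8.
rewrite -(block_op_commP PP PDQ).
have R1 x : RH H1 x = block_op P Q F1 G1 U1 V1 x.
  by rewrite /RH e1 e2 e3 e4 /block_op !PE !QE F1E G1E U1E V1E.
have R2 x : RH H2 x = block_op P Q F2 G2 U2 V2 x.
  by rewrite /RH e5 e6 e7 e8 /block_op !PE !QE F2E G2E U2E V2E.
split=> [com x|com].
  by rewrite -R2 -R1 -R1 -R2; exact: (congr1 (fun T => T x) com).
by apply/funext => x; rewrite /= R1 !R2 R1 com.
Qed.

Local Notation coef := (@fourier_coef R).
Local Notation z := (zn R).

Let combine (V : lmodType R[i]) (a1 a2 b1 b2 a1' a2' b1' b2' : R[i]) (X Y X' Y' : V) :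
  a1 *: X - b1 *: Y = a1' *: X' - b1' *: Y' ->
  b2 *: Y - a2 *: X = b2' *: Y' - a2' *: X' ->
  (a1 + a2) *: X - (b1 + b2) *: Y = (a1' + a2') *: X' - (b1' + b2') *: Y'.
Proof.
have sh (A A' B B' : V) : A + A' - (B + B') = (A - B) - (B' - A').
  by rewrite opprB opprD addrACA.
by move=> E1 E2; rewrite !scalerDl [LHS]sh [RHS]sh E1 E2.
Qed.

Let combine_pairs (V : lmodType R[i]) (k l k' l' a1 a2 b1 b2 a1' a2' b1' b2' : R[i])
    (X Y X' Y' Z W Z' W' : V) :
  k = a1 + a2 -> l = b1 + b2 -> k' = a1' + a2' -> l' = b1' + b2' ->
  a1 *: X - b1 *: Y = a1' *: X' - b1' *: Y' ->
  b2 *: Y - a2 *: X = b2' *: Y' - a2' *: X' ->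
  a1 *: Z - b1 *: W = a1' *: Z' - b1' *: W' ->
  b2 *: W - a2 *: Z = b2' *: W' - a2' *: Z' ->
  k *: (X, Z) - l *: (Y, W) = k' *: (X', Z') - l' *: (Y', W').
Proof.
move=> -> -> -> -> E1 E2 E3 E4.
exact: (f_equal2 pair (combine E1 E2) (combine E3 E4)).
Qed.

(** The first components of the two copies of the space give the entries starting
from the Hardy space, the second ones those starting from its complement. *)
Lemma blocks_commute_tensor : blocks_commute P Q F1 G1 U1 V1 F2 G2 U2 V2 ->
  forall x : L2 R * L2 R,
  inner2 x (Vop (Pminus f2), Pminus (conjL2 u2)) *: (Vop (Pminus (conjL2 f1)), Pminus g1)
  - inner2 x (Vop (Pminus g2), Pminus (conjL2 v2)) *: (Vop (Pminus (conjL2 u1)), Pminus v1)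
  =
  inner2 x (Vop (Pminus f1), Pminus (conjL2 u1)) *: (Vop (Pminus (conjL2 f2)), Pminus g2)
  - inner2 x (Vop (Pminus g1), Pminus (conjL2 v1)) *: (Vop (Pminus (conjL2 u2)), Pminus v2).
Proof.
move=> [hPP hQP hPQ hQQ] [x y].
have lz n := Linfty_zn R n.
have [S SE] := mulL2_linear (lz 1); have [S' S'E] := mulL2_linear (lz (-1)).
have SK w : S' (S w) = w by rewrite S'E SE mul_znA addNr mul_zn0.
have S'K w : S (S' w) = w by rewrite S'E SE mul_znA subrr mul_zn0.
have PSP w : Q (S (P w)) = 0.
  by rewrite QE SE PE Pminus_eq0//; apply: hardy_mul_zn => //; exact: hardy_Pplus.
have QSQ w : P (S' (Q w)) = 0.
  rewrite PE S'E QE Pplus_eq0//; apply: antihardy_mul_zn => //.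
  exact: antihardy_Pminus.
have sP w : P (S w) = S (P w) + coef w (-1) *: z 0.
  by rewrite !PE !SE Pplus_shift.
have sQ w : Q (S' w) = S' (Q w) + coef w 0 *: z (-1).
  by rewrite !QE !S'E Pminus_backshift.
have cS (A : {linear L2 R -> L2 R}) f : Linfty f -> (forall w, A w = f ** w) ->
  forall w, A (S w) = S (A w) by move=> lf AE; exact: comm lf (lz 1) AE SE.
have cS' (A : {linear L2 R -> L2 R}) f : Linfty f -> (forall w, A w = f ** w) ->
  forall w, A (S' w) = S' (A w) by move=> lf AE; exact: comm lf (lz (-1)) AE S'E.
have E1 := diagonal_entry_shift PDQ SK S'K PSP QSQ sP
  (cS _ _ lf1 F1E) (cS _ _ lf2 F2E) (cS _ _ lg1 G1E) (cS _ _ lg2 G2E)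
  (cS _ _ lu1 U1E) (cS _ _ lu2 U2E) hPP x.
have E2 := mixed_entry_shift PDQ PSP sP
  (cS _ _ lf1 F1E) (cS _ _ lf2 F2E) (cS _ _ lg1 G1E) (cS _ _ lg2 G2E)
  (cS _ _ lv1 V1E) (cS _ _ lv2 V2E) hQP x.
have hPQ' w : P (U1 (Q (V2 (Q w)))) + P (F1 (P (U2 (Q w)))) =
    P (U2 (Q (V1 (Q w)))) + P (F2 (P (U1 (Q w)))).
  by rewrite addrC hPQ addrC.
have hQQ' w : Q (V1 (Q (V2 (Q w)))) + Q (G1 (P (U2 (Q w)))) =
    Q (V2 (Q (V1 (Q w)))) + Q (G2 (P (U1 (Q w)))).
  by rewrite addrC hQQ addrC.
have E3 := mixed_entry_shift QPD QSQ sQ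
  (cS' _ _ lv1 V1E) (cS' _ _ lv2 V2E) (cS' _ _ lu1 U1E) (cS' _ _ lu2 U2E)
  (cS' _ _ lf1 F1E) (cS' _ _ lf2 F2E) hPQ' y.
have E4 := diagonal_entry_shift QPD S'K SK QSQ PSP sQ
  (cS' _ _ lv1 V1E) (cS' _ _ lv2 V2E) (cS' _ _ lu1 U1E) (cS' _ _ lu2 U2E)
  (cS' _ _ lg1 G1E) (cS' _ _ lg2 G2E) hQQ' y.
have S'z : S' (z 0) = z (-1) by rewrite S'E mul_zn addr0.
have Sz : S (z (-1)) = z 0 by rewrite SE mul_zn subrr.
rewrite S'z in E1; rewrite Sz in E4.
have Pz (A : {linear L2 R -> L2 R}) f : Linfty f -> (forall w, A w = f ** w) ->
    P (A (z (-1))) = Vop (Pminus (conjL2 f)).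
  by move=> lf AE; rewrite PE AE Vop_Pminus_conj.
have Qz (A : {linear L2 R -> L2 R}) f : Linfty f -> (forall w, A w = f ** w) ->
    Q (A (z 0)) = Pminus f.
  by move=> lf AE; rewrite QE AE mulL2_zn0.
rewrite !(Pz _ _ lf1 F1E) (Pz _ _ lu1 U1E) (Pz _ _ lf2 F2E) (Pz _ _ lu2 U2E) in E1 E3.
rewrite !(Qz _ _ lg1 G1E) (Qz _ _ lv1 V1E) (Qz _ _ lg2 G2E) (Qz _ _ lv2 V2E) in E2 E4.
have inE (A B : {linear L2 R -> L2 R}) f u : Linfty f -> Linfty u ->
    (forall w, A w = f ** w) -> (forall w, B w = u ** w) ->
    inner2 (x, y) (Vop (Pminus f), Pminus (conjL2 u)) =
    coef (A (P x)) (-1) + coef (B (Q y)) 0.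
  move=> lf lu AE BE; rewrite /inner2 [X in X + _](inner_Vop_Pminus _ lf).
  by rewrite [X in _ + X](inner_Pminus_conj _ lu) AE BE PE QE.
exact: (combine_pairs (inE _ _ _ _ lf2 lu2 F2E U2E) (inE _ _ _ _ lg2 lv2 G2E V2E)
  (inE _ _ _ _ lf1 lu1 F1E U1E) (inE _ _ _ _ lg1 lv1 G1E V1E) E1 E3 E2 E4).
Qed.

End symbols.

(** * The theorem *)

Section inner2_form.
Context (R : realType).

Lemma inner2_linear_form (q : L2 R * L2 R) :
  linear_form (fun x : L2 R * L2 R => inner2 x q).
Proof.
move=> k [x1 x2] [y1 y2]; rewrite /inner2 /= !innerDl !innerZl mulrDr.
by rewrite addrACA.
Qed.

End inner2_form.

Theorem theorem4p7 (R : realType) (H1 H2 : 'M[L2 R]_2)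
    (hH1 : forall i j, Linfty (H1 i j)) (hH2 : forall i j, Linfty (H2 i j)) :
  let f1 := H1 0 0 in let u1 := H1 0 1 in
  let g1 := H1 1 0 in let v1 := H1 1 1 in
  let f2 := H2 0 0 in let u2 := H2 0 1 in
  let g2 := H2 1 0 in let v2 := H2 1 1 in
  has_rank
    (tensor (Vop (Pminus (conjL2 f1)), Pminus g1)
            (Vop (Pminus f2), Pminus (conjL2 u2)) \-
     tensor (Vop (Pminus (conjL2 u1)), Pminus v1)
            (Vop (Pminus g2), Pminus (conjL2 v2))) 2 ->
  has_rank
    (tensor (Vop (Pminus (conjL2 f2)), Pminus g2)
            (Vop (Pminus f1), Pminus (conjL2 u1)) \-
     tensor (Vop (Pminus (conjL2 u2)), Pminus v2)
            (Vop (Pminus g1), Pminus (conjL2 v1))) 2 ->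
  RH H1 \o RH H2 = RH H2 \o RH H1 <->
  exists a b c d : R[i],
    Hinfty (conjL2 f1 - a^*%C *: conjL2 f2 - b^*%C *: conjL2 u2) /\
    Hinfty (g1 - a *: g2 - b *: v2) /\
    Hinfty (conjL2 u1 - c^*%C *: conjL2 f2 - d^*%C *: conjL2 u2) /\
    Hinfty (v1 - c *: g2 - d *: v2) /\
    Hinfty (f1 - a *: f2 + c *: g2) /\
    Hinfty (conjL2 u1 - a^*%C *: conjL2 u2 + c^*%C *: conjL2 v2) /\
    Hinfty (g1 + b *: f2 - d *: g2) /\
    Hinfty (conjL2 v1 + b^*%C *: conjL2 u2 - d^*%C *: conjL2 v2) /\
    Hinfty (conjL2 u2 ** conjL2 f1 - conjL2 v1 ** conjL2 u2
            - a^*%C *: (conjL2 u2 ** conjL2 f2)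
            - b^*%C *: (conjL2 u2 ** conjL2 u2)
            + c^*%C *: (conjL2 v2 ** conjL2 f2)
            + d^*%C *: (conjL2 v2 ** conjL2 u2)) /\
    Hinfty (v1 ** g2 - f1 ** g2 + a *: (g2 ** f2) + b *: (v2 ** f2)
            - c *: (g2 ** g2) - d *: (v2 ** g2)).
Proof.
move=> f1 u1 g1 v1 f2 u2 g2 v2.
have lf1 : Linfty f1 := hH1 0 0. have lu1 : Linfty u1 := hH1 0 1.
have lg1 : Linfty g1 := hH1 1 0. have lv1 : Linfty v1 := hH1 1 1.
have lf2 : Linfty f2 := hH2 0 0. have lu2 : Linfty u2 := hH2 0 1.
have lg2 : Linfty g2 := hH2 1 0. have lv2 : Linfty v2 := hH2 1 1.
have ef1 : H1 0 0 = f1 by []. have eu1 : H1 0 1 = u1 by [].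
have eg1 : H1 1 0 = g1 by []. have ev1 : H1 1 1 = v1 by [].
have ef2 : H2 0 0 = f2 by []. have eu2 : H2 0 1 = u2 by [].
have eg2 : H2 1 0 = g2 by []. have ev2 : H2 1 1 = v2 by [].
(* From here on the entries are variables, with the equations kept above. *)
clearbody f1 u1 g1 v1 f2 u2 g2 v2.
move=> rk1 rk2.
have [F1 F1E] := mulL2_linear lf1; have [U1 U1E] := mulL2_linear lu1.
have [G1 G1E] := mulL2_linear lg1; have [V1 V1E] := mulL2_linear lv1.
have [F2 F2E] := mulL2_linear lf2; have [U2 U2E] := mulL2_linear lu2.
have [G2 G2E] := mulL2_linear lg2; have [V2 V2E] := mulL2_linear lv2.
have [P PE] := Pplus_linear R; have [Q QE] := Pminus_linear R.
rewrite (RH_commP F1E G1E U1E V1E F2E G2E U2E V2E PE QE ef1 eu1 eg1 ev1 ef2 eu2 eg2 ev2).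
have BC a b c d := @blocks_commuteP R f1 g1 u1 v1 f2 g2 u2 v2
  lf1 lg1 lu1 lv1 lf2 lg2 lu2 lv2 F1 G1 U1 V1 F2 G2 U2 V2
  F1E G1E U1E V1E F2E G2E U2E V2E P Q PE QE a b c d.
split=> [com|[a [b [c [d]]]]]; last first.
  move=> [[_ h1] [[_ h2] [[_ h3] [[_ h4] [[_ h5] [[_ h6] [[_ h7] [[_ h8]]]]]]]]].
  move=> [[_ h9] [_ h10]].
  apply/(BC a b c d h1 h2 h3 h4 h5 h6 h7 h8); split=> //.
  by rewrite conj_antianalytic_symbol.
have teq := blocks_commute_tensor lf1 lg1 lu1 lv1 lf2 lg2 lu2 lv2
  F1E G1E U1E V1E F2E G2E U2E V2E PE QE com.
have [a [b [c [d [p1 p2 m1 m2]]]]] := rank_two_eq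
  (inner2_linear_form _) (inner2_linear_form _)
  (inner2_linear_form _) (inner2_linear_form _) rk1 rk2 teq.
have [p11 p12] := (congr1 fst p1, congr1 snd p1).
have [p21 p22] := (congr1 fst p2, congr1 snd p2).
have inner0 w : inner (0 : L2 R) w = 0 by exact: inner0l.
have fstE (k l : R[i]) (q q1 q2 : L2 R * L2 R) :
    (forall x, inner2 x q = k * inner2 x q1 - l * inner2 x q2) ->
    q.1 = k^*%C *: q1.1 - l^*%C *: q2.1.
  move=> H; apply: inner_inj => x; have := H (x, 0).
  by rewrite /inner2 /= !inner0 !addr0 innerBr !innerZr !conjcK.
have sndE (k l : R[i]) (q q1 q2 : L2 R * L2 R) :
    (forall x, inner2 x q = k * inner2 x q1 - l * inner2 x q2) ->
    q.2 = k^*%C *: q1.2 - l^*%C *: q2.2.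
  move=> H; apply: inner_inj => x; have := H (0, x).
  by rewrite /inner2 /= !inner0 !add0r innerBr !innerZr !conjcK.
have m11 := fstE _ _ _ _ _ m1; have m12 := sndE _ _ _ _ _ m1.
have m21 := fstE _ _ _ _ _ m2; have m22 := sndE _ _ _ _ _ m2.
rewrite /= in p11 p12 p21 p22 m11 m12 m21 m22.
have h1 := hardy_of_Vop p11; have h2 := hardy_of_Pminus p12.
have h3 := hardy_of_Vop p21; have h4 := hardy_of_Pminus p22.
have h5 := hardy_of_Vop' m11; have h6 := hardy_of_Pminus' m12.
have h7 := hardy_of_Vop' m21; have h8 := hardy_of_Pminus' m22.
rewrite addrAC in h7; rewrite addrAC in h8.
have [h9 h10] := (BC a b c d h1 h2 h3 h4 h5 h6 h7 h8).1 com.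
have BB k l (f g h : L2 R) (lf : Linfty f) (lg : Linfty g) (lh : Linfty h) :=
  LinftyB (LinftyB lf (LinftyZ k lg)) (LinftyZ l lh).
have BD k l (f g h : L2 R) (lf : Linfty f) (lg : Linfty g) (lh : Linfty h) :=
  LinftyD (LinftyB lf (LinftyZ k lg)) (LinftyZ l lh).
have DB k l (f g h : L2 R) (lf : Linfty f) (lg : Linfty g) (lh : Linfty h) :=
  LinftyB (LinftyD lf (LinftyZ k lg)) (LinftyZ l lh).
have lcf1 := Linfty_conj lf1; have lcu1 := Linfty_conj lu1.
have lcv1 := Linfty_conj lv1; have lcf2 := Linfty_conj lf2.
have lcu2 := Linfty_conj lu2; have lcv2 := Linfty_conj lv2.
have l9 := Linfty_conj
  (Linfty_antianalytic_symbol lf1 lv1 lf2 lu2 lv2 a b c d).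
have l10 := Linfty_analytic_symbol lf1 lv1 lf2 lg2 lv2 a b c d.
rewrite (@conj_antianalytic_symbol R f1 v1 f2 u2 v2 lv1 lu2 lv2) in h9 l9.
exists a, b, c, d.
split; first exact: (conj (BB _ _ _ _ _ lcf1 lcf2 lcu2) h1).
split; first exact: (conj (BB _ _ _ _ _ lg1 lg2 lv2) h2).
split; first exact: (conj (BB _ _ _ _ _ lcu1 lcf2 lcu2) h3).
split; first exact: (conj (BB _ _ _ _ _ lv1 lg2 lv2) h4).
split; first exact: (conj (BD _ _ _ _ _ lf1 lf2 lg2) h5).
split; first exact: (conj (BD _ _ _ _ _ lcu1 lcu2 lcv2) h6).
split; first exact: (conj (DB _ _ _ _ _ lg1 lf2 lg2) h7).
split; first exact: (conj (DB _ _ _ _ _ lcv1 lcu2 lcv2) h8).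
exact: (conj (conj l9 h9) (conj l10 h10)).
Qed.
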